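(* Let $q$ be a non-zero complex number which is not a root of unity and let $U^+=U_q^+(B_2)$. For $\alpha,\beta\in\mathbb{C}^*$ let $\psi_{\alpha,\beta}$ denote the automorphism of the algebra $U^+$ defined by $\psi_{\alpha,\beta}(e_1)=\alpha e_1$ and $\psi_{\alpha,\beta}(e_2)=\beta e_2$. Then the group $\mathrm{Aut}(U^+)$ of algebra automorphisms of $U^+$ is $$\mathrm{Aut}(U^+)=\{\psi_{\alpha,\beta}\mid \alpha,\beta\in\mathbb{C}^*\}.$$ Hence $\mathrm{Aut}(U^+)$ is isomorphic to the torus $(\mathbb{C}^* )^2$.
   Context: $U^+=U_q^+(B_2)$ is the unital associative $\mathbb{C}$-algebra generated by $e_1,e_2$ subject to the quantum Serre relations $e_1^2e_2-(q^2+q^{-2})e_1e_2e_1+e_2e_1^2=0$ and $e_2^3e_1-(q^2+1+q^{-2})e_2^2e_1e_2+(q^2+1+q^{-2})e_2e_1e_2^2-e_1e_2^3=0$. Automorphisms are $\mathbb{C}$-algebra automorphisms. *)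

(* Defs.v *)
From HB Require Import structures.
From mathcomp Require Import all_boot all_order all_algebra generic_quotient.
From mathcomp Require Import finmap monalg complex ring.
From mathcomp Require Import boolp classical_sets reals.

Set Implicit Arguments.
Unset Strict Implicit.
Unset Printing Implicit Defensive.

Import GRing.Theory.

Local Open Scope ring_scope.
Local Open Scope quotient_scope.

Section TwoSidedIdeal.
Variable A : nzRingType.

(* Closure under opposite follows from [ideal_mull] with left factor -1. *)
Inductive ideal_generated (S : set A) : A -> Prop :=
| ideal_gen x : S x -> ideal_generated S x
| ideal_0 : ideal_generated S 0
| ideal_add x y :
    ideal_generated S x -> ideal_generated S y -> ideal_generated S (x + y)
| ideal_mull a x : ideal_generated S x -> ideal_generated S (a * x)
| ideal_mulr a x : ideal_generated S x -> ideal_generated S (x * a).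

Lemma ideal_opp S x : ideal_generated S x -> ideal_generated S (- x).
Proof. by rewrite -mulN1r; apply: ideal_mull. Qed.

End TwoSidedIdeal.

Section SerreRelations.
Variables (K : fieldType) (A : algType K).

Definition serre1 (q : K) (a1 a2 : A) : A :=
  a1 ^+ 2 * a2 - (q ^+ 2 + q ^- 2) *: (a1 * a2 * a1) + a2 * a1 ^+ 2.

Definition serre2 (q : K) (a1 a2 : A) : A :=
  a2 ^+ 3 * a1 - (q ^+ 2 + 1 + q ^- 2) *: (a2 ^+ 2 * a1 * a2)
  + (q ^+ 2 + 1 + q ^- 2) *: (a2 * a1 * a2 ^+ 2) - a1 * a2 ^+ 3.

Lemma mulZZ (c d : K) (u v : A) : (c *: u) * (d *: v) = (c * d) *: (u * v).
Proof. by rewrite -scalerAl -scalerAr scalerA. Qed.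

Lemma serre1_scale q (a b : K) (a1 a2 : A) :
  serre1 q (a *: a1) (b *: a2) = (a ^+ 2 * b) *: serre1 q a1 a2.
Proof.
rewrite /serre1 !exprZn !mulZZ scalerDr scalerBr !scalerA.
by congr (_ - _ *: _ + _ *: _); ring.
Qed.

Lemma serre2_scale q (a b : K) (a1 a2 : A) :
  serre2 q (a *: a1) (b *: a2) = (a * b ^+ 3) *: serre2 q a1 a2.
Proof.
rewrite /serre2 !exprZn !mulZZ scalerBr scalerDr scalerBr !scalerA.
by congr (_ *: _ - _ *: _ + _ *: _ - _ *: _); ring.
Qed.

End SerreRelations.

Lemma rmorph_serre1 (K : fieldType) (A B : algType K) (f : {lrmorphism A -> B})
  q a1 a2 : f (serre1 q a1 a2) = serre1 q (f a1) (f a2).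
Proof. by rewrite rmorphD rmorphB /= linearZ !rmorphM. Qed.

Lemma rmorph_serre2 (K : fieldType) (A B : algType K) (f : {lrmorphism A -> B})
  q a1 a2 : f (serre2 q a1 a2) = serre2 q (f a1) (f a2).
Proof. by rewrite rmorphB rmorphD rmorphB /= ![f (_ *: _)]linearZ !rmorphM. Qed.

Section FreeAlgebra.
Variable K : fieldType.

(* The free unital associative K-algebra on two generators, as the monoid
   algebra of the free monoid on two letters. *)
Definition free_alg := {malg K[{fmonom 'I_2}]}.

HB.instance Definition _ := GRing.Lalgebra.on free_alg.

Fact free_alg_scalerAr (c : K) (x y : free_alg) : c *: (x * y) = x * (c *: y).
Proof.
have comm (z : free_alg) : z * malgC c = malgC c * z.
  rewrite mul_malgC malgM_def fgmulgU malgZ_def.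
  by apply: eq_bigr => k _; rewrite mulm1 mulrC.
by rewrite -[c *: y]mul_malgC -[c *: (x * y)]mul_malgC !mulrA comm.
Qed.

HB.instance Definition _ :=
  GRing.Lalgebra_isAlgebra.Build K free_alg free_alg_scalerAr.

Definition free_gen (i : 'I_2) : free_alg := mkmalgU (fmu i) 1.

Variables (A : algType K) (a : 'I_2 -> A).

Definition word_eval (m : {fmonom 'I_2}) : A := \prod_(i <- m) a i.

Fact word_eval_mmorphism : mmorphism word_eval.
Proof.
split=> [m1 m2|]; first by rewrite /word_eval fmM big_cat.
by rewrite /word_eval fm1 big_nil.
Qed.

HB.instance Definition _ :=
  isMultiplicative.Build {fmonom 'I_2} A word_eval word_eval_mmorphism.

Definition free_lift (x : free_alg) : A := mmap (in_alg A) word_eval x.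

Fact free_lift_additive : zmod_morphism free_lift.
Proof. exact: mmap_is_additive. Qed.

Fact free_lift_monoid : monoid_morphism free_lift.
Proof.
have [fM f1] : multiplicative free_lift.
  apply: commr_mmap_is_multiplicative => g m m'.
  by rewrite /GRing.comm /= -scalerAl mul1r -scalerAr mulr1.
by split.
Qed.

Fact free_lift_scalable : scalable free_lift.
Proof. by move=> c x; rewrite /free_lift mmapZ /= -scalerAl mul1r. Qed.

HB.instance Definition _ :=
  GRing.isZmodMorphism.Build free_alg A free_lift free_lift_additive.
HB.instance Definition _ :=
  GRing.isMonoidMorphism.Build free_alg A free_lift free_lift_monoid.
HB.instance Definition _ :=
  GRing.isScalable.Build K free_alg A *:%R free_lift free_lift_scalable.

Lemma free_lift_gen i : free_lift (free_gen i) = a i.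
Proof.
by rewrite /free_lift mmapU /= scale1r mul1r /word_eval fmU big_seq1.
Qed.

Lemma free_lift_unique (f : {lrmorphism free_alg -> A}) :
  (forall i, f (free_gen i) = a i) -> f =1 free_lift.
Proof.
move=> fE x; rewrite (monalgE x) !raddf_sum; apply: eq_bigr => m _.
have -> : mkmalgU m (mcoeff m x) = (mcoeff m x : K) *: (mkmalgU m 1 : free_alg).
  by rewrite -mul_malgC malgM_def fgmulUU mul1m mulr1.
rewrite [LHS]linearZ [RHS]linearZ /=; congr (_ *: _).
case: m => s; elim: s => [|i s IHs].
  have -> : FMonom [::] = mone :> {fmonom 'I_2} by apply/val_inj; rewrite /= fm1.
  by rewrite [LHS]rmorph1 [RHS]rmorph1.
have -> : mkmalgU (FMonom (i :: s)) 1 = free_gen i * mkmalgU (FMonom s) 1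
    :> free_alg.
  rewrite malgM_def fgmulUU mulr1; congr mkmalgU.
  by apply/val_inj; rewrite [RHS]fmM fmU.
by rewrite [LHS]rmorphM [RHS]rmorphM /= fE free_lift_gen IHs.
Qed.

End FreeAlgebra.

(* U_q^+(B_2): the quotient of the free algebra on X1, X2 by the two-sided ideal
   generated by the quantum Serre relators. *)
Section PositivePart.
Variables (K : fieldType) (q : K).

Local Notation F := (free_alg K).
Local Notation X1 := (free_gen K ord0).
Local Notation X2 := (free_gen K ord_max).

Definition serre_ideal : F -> Prop :=
  ideal_generated [set serre1 q X1 X2; serre2 q X1 X2]%classic.

Definition serre_rel : rel F := fun x y => `[< serre_ideal (x - y) >].

Fact serre_rel_refl : reflexive serre_rel.
Proof. by move=> x; apply/asboolP; rewrite subrr; apply: ideal_0. Qed.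

Fact serre_rel_sym : symmetric serre_rel.
Proof.
by move=> x y; apply/asboolP/asboolP => /ideal_opp; rewrite opprB.
Qed.

Fact serre_rel_trans : transitive serre_rel.
Proof.
move=> y x z /asboolP xy /asboolP yz; apply/asboolP.
by rewrite -(subrK y x) -addrA; apply: ideal_add.
Qed.

Canonical serre_equiv :=
  EquivRel serre_rel serre_rel_refl serre_rel_sym serre_rel_trans.

Definition Uq := {eq_quot serre_rel}.

HB.instance Definition _ := Choice.on Uq.
HB.instance Definition _ := EqQuotient.on Uq.

Definition Uq_pi (x : F) : Uq := \pi_Uq x.

Lemma Uq_piP (u : Uq) : exists x, u = Uq_pi x.
Proof. by exists (repr u); rewrite /Uq_pi reprK. Qed.

Lemma Uq_eqP (x y : F) : Uq_pi x = Uq_pi y <-> serre_ideal (x - y).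
Proof.
split=> [xy|xy]; first exact/asboolP/(eqmodP serre_equiv).
by apply/(eqmodP serre_equiv)/asboolP.
Qed.

Lemma Uq_reprB (x : F) : serre_ideal (repr (Uq_pi x) - x).
Proof. by apply/Uq_eqP; rewrite /Uq_pi reprK. Qed.

Definition Uq_add : Uq -> Uq -> Uq := lift_op2 Uq +%R.
Definition Uq_opp : Uq -> Uq := lift_op1 Uq -%R.
Definition Uq_mul : Uq -> Uq -> Uq := lift_op2 Uq *%R.
Definition Uq_scale (c : K) : Uq -> Uq := lift_op1 Uq ( *:%R c).

Fact Uq_piD x y : Uq_add (Uq_pi x) (Uq_pi y) = Uq_pi (x + y).
Proof.
rewrite /Uq_add; unlock; apply/Uq_eqP; rewrite opprD addrACA.
by apply: ideal_add; apply: Uq_reprB.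
Qed.

Fact Uq_piN x : Uq_opp (Uq_pi x) = Uq_pi (- x).
Proof.
rewrite /Uq_opp; unlock; apply/Uq_eqP; rewrite -opprD.
exact/ideal_opp/Uq_reprB.
Qed.

Fact Uq_piM x y : Uq_mul (Uq_pi x) (Uq_pi y) = Uq_pi (x * y).
Proof.
rewrite /Uq_mul; unlock; apply/Uq_eqP.
rewrite -(subrK (x * repr (Uq_pi y)) (_ * repr _)).
rewrite -mulrBl -addrA -mulrBr; apply: ideal_add.
  exact/ideal_mulr/Uq_reprB.
exact/ideal_mull/Uq_reprB.
Qed.

Fact Uq_piZ c x : Uq_scale c (Uq_pi x) = Uq_pi (c *: x).
Proof.
rewrite /Uq_scale; unlock; apply/Uq_eqP.
rewrite -scalerBr -[_ - _]mul1r scalerAl.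
exact/ideal_mull/Uq_reprB.
Qed.

Fact Uq_addA : associative Uq_add.
Proof.
move=> u v w; have [x ->] := Uq_piP u; have [y ->] := Uq_piP v.
have [z ->] := Uq_piP w.
by rewrite !Uq_piD addrA.
Qed.

Fact Uq_addC : commutative Uq_add.
Proof. 
by move=> u v; have [x ->] := Uq_piP u; have [y ->] := Uq_piP v;
rewrite !Uq_piD addrC. Qed.

Fact Uq_add0 : left_id (Uq_pi 0) Uq_add.
Proof. by move=> u; have [x ->] := Uq_piP u; rewrite Uq_piD add0r. Qed.

Fact Uq_addN : left_inverse (Uq_pi 0) Uq_opp Uq_add.
Proof. by move=> u; have [x ->] := Uq_piP u; rewrite Uq_piN Uq_piD addNr. Qed.

HB.instance Definition _ :=
  GRing.isZmodule.Build Uq Uq_addA Uq_addC Uq_add0 Uq_addN.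

Fact Uq_mulA : associative Uq_mul.
Proof.
move=> u v w; have [x ->] := Uq_piP u; have [y ->] := Uq_piP v.
have [z ->] := Uq_piP w.
by rewrite !Uq_piM mulrA.
Qed.

Fact Uq_mul1 : left_id (Uq_pi 1) Uq_mul.
Proof. by move=> u; have [x ->] := Uq_piP u; rewrite Uq_piM mul1r. Qed.

Fact Uq_mulr1 : right_id (Uq_pi 1) Uq_mul.
Proof. by move=> u; have [x ->] := Uq_piP u; rewrite Uq_piM mulr1. Qed.

Fact Uq_mulDl : left_distributive Uq_mul Uq_add.
Proof.
move=> u v w; have [x ->] := Uq_piP u; have [y ->] := Uq_piP v.
have [z ->] := Uq_piP w.
by rewrite !(Uq_piM, Uq_piD) mulrDl.
Qed.

Fact Uq_mulDr : right_distributive Uq_mul Uq_add.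
Proof.
move=> u v w; have [x ->] := Uq_piP u; have [y ->] := Uq_piP v.
have [z ->] := Uq_piP w.
by rewrite !(Uq_piM, Uq_piD) mulrDr.
Qed.

Lemma serre_ideal_lift (A : algType K) (f : {lrmorphism F -> A}) :
  serre1 q (f X1) (f X2) = 0 -> serre2 q (f X1) (f X2) = 0 ->
  forall x, serre_ideal x -> f x = 0.
Proof.
move=> f1 f2 x; elim=> {x} [x [->|->]||x y _ fx _ fy|a x _ fx|a x _ fx].
- by rewrite rmorph_serre1.
- by rewrite rmorph_serre2.
- exact: rmorph0.
- by rewrite rmorphD /= fx fy addr0.
- by rewrite rmorphM /= fx mulr0.
- by rewrite rmorphM /= fx mul0r.
Qed.

(* The augmentation sending both generators to 0 kills the ideal but not 1. *)
Fact Uq_nontriv : Uq_pi 1 != Uq_pi 0.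
Proof.
apply/eqP => /Uq_eqP; rewrite subr0.
pose f : {lrmorphism F -> K^o} := free_lift (fun _ => 0 : K^o).
have fE i : f (free_gen K i) = 0 by exact: free_lift_gen.
move=> /(serre_ideal_lift (f := f)); rewrite !fE.
rewrite /serre1 /serre2 !(expr0n, mulr0, mul0r, scaler0).
rewrite !(addr0, subr0) rmorph1 => /(_ erefl erefl) /eqP.
by rewrite oner_eq0.
Qed.

HB.instance Definition _ := GRing.Zmodule_isNzRing.Build Uq
  Uq_mulA Uq_mul1 Uq_mulr1 Uq_mulDl Uq_mulDr Uq_nontriv.

Fact Uq_scaleA a b (u : Uq) : Uq_scale a (Uq_scale b u) = Uq_scale (a * b) u.
Proof. by have [x ->] := Uq_piP u; rewrite !Uq_piZ scalerA. Qed.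

Fact Uq_scale1 : left_id 1 Uq_scale.
Proof. by move=> u; have [x ->] := Uq_piP u; rewrite Uq_piZ scale1r. Qed.

Fact Uq_scaleDr : right_distributive Uq_scale +%R.
Proof.
move=> c u v; have [x ->] := Uq_piP u; have [y ->] := Uq_piP v.
by rewrite [_ + _]Uq_piD !Uq_piZ [RHS]Uq_piD scalerDr.
Qed.

Fact Uq_scaleDl (u : Uq) : {morph Uq_scale^~ u : a b / a + b}.
Proof.
by move=> a b; have [x ->] := Uq_piP u; rewrite !Uq_piZ [RHS]Uq_piD scalerDl.
Qed.

HB.instance Definition _ := GRing.Zmodule_isLmodule.Build K Uq
  Uq_scaleA Uq_scale1 Uq_scaleDr Uq_scaleDl.

Fact Uq_scaleAl c (u v : Uq) : c *: (u * v) = (c *: u) * v.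
Proof.
have piZ a x : a *: Uq_pi x = Uq_pi (a *: x) := Uq_piZ a x.
have piM x y : Uq_pi x * Uq_pi y = Uq_pi (x * y) := Uq_piM x y.
have [x ->] := Uq_piP u; have [y ->] := Uq_piP v.
by rewrite !piM !piZ piM scalerAl.
Qed.

HB.instance Definition _ := GRing.Lmodule_isLalgebra.Build K Uq Uq_scaleAl.

Fact Uq_scaleAr c (u v : Uq) : c *: (u * v) = u * (c *: v).
Proof.
have piZ a x : a *: Uq_pi x = Uq_pi (a *: x) := Uq_piZ a x.
have piM x y : Uq_pi x * Uq_pi y = Uq_pi (x * y) := Uq_piM x y.
have [x ->] := Uq_piP u; have [y ->] := Uq_piP v.
by rewrite !piM !piZ piM scalerAr.
Qed.

HB.instance Definition _ := GRing.Lalgebra_isAlgebra.Build K Uq Uq_scaleAr.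

Fact Uq_pi_zmod : zmod_morphism Uq_pi.
Proof. by move=> x y; rewrite -Uq_piD -Uq_piN. Qed.

Fact Uq_pi_monoid : monoid_morphism Uq_pi.
Proof. by split=> // x y; rewrite -Uq_piM. Qed.

Fact Uq_pi_scalable : scalable Uq_pi.
Proof. by move=> c x; rewrite -Uq_piZ. Qed.

HB.instance Definition _ := GRing.isZmodMorphism.Build F Uq Uq_pi Uq_pi_zmod.
HB.instance Definition _ :=
  GRing.isMonoidMorphism.Build F Uq Uq_pi Uq_pi_monoid.
HB.instance Definition _ :=
  GRing.isScalable.Build K F Uq *:%R Uq_pi Uq_pi_scalable.

Definition e1 : Uq := Uq_pi X1.
Definition e2 : Uq := Uq_pi X2.

Lemma Uq_serre1 : serre1 q e1 e2 = 0.
Proof.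
rewrite -rmorph_serre1 -(rmorph0 Uq_pi); apply/Uq_eqP; rewrite subr0.
by apply: ideal_gen; left.
Qed.

Lemma Uq_serre2 : serre2 q e1 e2 = 0.
Proof.
rewrite -rmorph_serre2 -(rmorph0 Uq_pi); apply/Uq_eqP; rewrite subr0.
by apply: ideal_gen; right.
Qed.


Lemma Uq_hom_ext (A : algType K) (f g : {lrmorphism Uq -> A}) :
  f e1 = g e1 -> f e2 = g e2 -> f =1 g.
Proof.
move=> fg1 fg2 u; have [x ->] := Uq_piP u.
pose a (i : 'I_2) := g (Uq_pi (free_gen K i)).
have fE i : (f \o Uq_pi) (free_gen K i) = a i.
  by case: i => [[|[|//]] lti]; [move: fg1|move: fg2];
    rewrite /a /e1 /e2 /=; (have -> : Ordinal lti = ord0 by apply/val_inj)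
      || (have -> : Ordinal lti = ord_max by apply/val_inj).
have gE i : (g \o Uq_pi) (free_gen K i) = a i by [].
by rewrite -[LHS]/((f \o Uq_pi) x) (free_lift_unique fE) -(free_lift_unique gE).
Qed.

Section Lift.
Variables (A : algType K) (a1 a2 : A).
Hypotheses (a_serre1 : serre1 q a1 a2 = 0) (a_serre2 : serre2 q a1 a2 = 0).

Let a (i : 'I_2) : A := if i == ord0 then a1 else a2.

Definition Uq_lift of serre1 q a1 a2 = 0 & serre2 q a1 a2 = 0 :=
  fun u : Uq => free_lift a (repr u).

Local Notation lift := (Uq_lift a_serre1 a_serre2).

Fact Uq_lift_pi x : lift (Uq_pi x) = free_lift a x.
Proof.
apply/eqP; rewrite -subr_eq0 -rmorphB; apply/eqP.
by apply: serre_ideal_lift (Uq_reprB x); rewrite /= !free_lift_gen.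
Qed.

Fact Uq_lift_zmod : zmod_morphism lift.
Proof.
move=> u v; have [x ->] := Uq_piP u; have [y ->] := Uq_piP v.
by rewrite -rmorphB !Uq_lift_pi rmorphB.
Qed.

Fact Uq_lift_monoid : monoid_morphism lift.
Proof.
split=> [|u v]; first by rewrite -(rmorph1 Uq_pi) Uq_lift_pi rmorph1.
have [x ->] := Uq_piP u; have [y ->] := Uq_piP v.
by rewrite -rmorphM !Uq_lift_pi rmorphM.
Qed.

Fact Uq_lift_scalable : scalable lift.
Proof.
move=> c u; have [x ->] := Uq_piP u.
by rewrite -linearZ !Uq_lift_pi linearZ.
Qed.

HB.instance Definition _ := GRing.isZmodMorphism.Build Uq A lift Uq_lift_zmod.
HB.instance Definition _ :=
  GRing.isMonoidMorphism.Build Uq A lift Uq_lift_monoid.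
HB.instance Definition _ :=
  GRing.isScalable.Build K Uq A *:%R lift Uq_lift_scalable.

Lemma Uq_lift_e1 : lift e1 = a1.
Proof. by rewrite Uq_lift_pi free_lift_gen. Qed.

Lemma Uq_lift_e2 : lift e2 = a2.
Proof. by rewrite Uq_lift_pi free_lift_gen. Qed.

End Lift.

End PositivePart.

Section AutomorphismGroup.
Variables (K : fieldType) (A : algType K).

(* K-algebra automorphisms of A, forming a group under composition. *)
Record algAut := AlgAut {
  algAut_mor :> {lrmorphism A -> A};
  algAut_bij : bijective algAut_mor }.

Lemma algAutP (f g : algAut) : f =1 g -> f = g.
Proof.
case: f g => [[f [[f1] [f2] [f3]]] fb] [[g [[g1] [g2] [g3]]] gb] /= /funext fg.
case: _ / fg in g1 g2 g3 gb *.
rewrite (Prop_irrelevance g1 f1) (Prop_irrelevance g2 f2).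
by rewrite (Prop_irrelevance g3 f3) in gb *; rewrite (Prop_irrelevance gb fb).
Qed.

HB.instance Definition _ := gen_eqMixin algAut.
HB.instance Definition _ := gen_choiceMixin algAut.

Definition algAut_one : algAut :=
  AlgAut (algAut_mor := idfun)
  (Bijective (fun x => erefl x) (fun x => erefl x)).

Definition algAut_mul (f g : algAut) : algAut :=
  AlgAut (algAut_mor := f \o g) (bij_comp (algAut_bij f) (algAut_bij g)).

Section Inverse.
Variable f : algAut.

Fact algAut_surj (y : A) : exists x, f x == y.
Proof. by case: (algAut_bij f) => g _ fK; exists (g y); rewrite fK. Qed.

Definition algAut_invfun (y : A) : A := xchoose (algAut_surj y).

Fact algAut_invfunK : cancel algAut_invfun f.
Proof. by move=> y; apply/eqP/(xchooseP (algAut_surj y)). Qed.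

Fact algAutK : cancel f algAut_invfun.
Proof. by move=> x; apply: (bij_inj (algAut_bij f)); rewrite algAut_invfunK. Qed.

Fact algAut_inv_zmod : zmod_morphism algAut_invfun.
Proof. exact: can2_zmod_morphism algAutK algAut_invfunK. Qed.

Fact algAut_inv_monoid : monoid_morphism algAut_invfun.
Proof. exact: can2_monoid_morphism algAutK algAut_invfunK. Qed.

Fact algAut_inv_scalable : scalable algAut_invfun.
Proof. exact: can2_scalable algAutK algAut_invfunK. Qed.

HB.instance Definition _ :=
  GRing.isZmodMorphism.Build A A algAut_invfun algAut_inv_zmod.
HB.instance Definition _ :=
  GRing.isMonoidMorphism.Build A A algAut_invfun algAut_inv_monoid.
HB.instance Definition _ :=
  GRing.isScalable.Build K A A *:%R algAut_invfun algAut_inv_scalable.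

Definition algAut_inv : algAut :=
  AlgAut (algAut_mor := algAut_invfun) (Bijective algAut_invfunK algAutK).

End Inverse.

Fact algAut_mulA : associative algAut_mul.
Proof. by move=> f g h; apply: algAutP. Qed.

Fact algAut_mul1 : left_id algAut_one algAut_mul.
Proof. by move=> f; apply: algAutP. Qed.

Fact algAut_mulr1 : right_id algAut_one algAut_mul.
Proof. by move=> f; apply: algAutP. Qed.

Fact algAut_mulV : left_inverse algAut_one algAut_inv algAut_mul.
Proof. by move=> f; apply: algAutP => x; apply: algAutK. Qed.

Fact algAut_mulrV : right_inverse algAut_one algAut_inv algAut_mul.
Proof. by move=> f; apply: algAutP => x; apply: algAut_invfunK. Qed.

HB.instance Definition _ := isGroup.Build algAut
  algAut_mulA algAut_mul1 algAut_mulr1 algAut_mulV algAut_mulrV.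

End AutomorphismGroup.

Section MultiplicativeGroup.
Variable K : fieldType.

(* The multiplicative group of the field, as a group type. *)
Record nonzero := Nonzero { nonzero_val :> K; nonzeroP : nonzero_val != 0 }.

HB.instance Definition _ := [isSub for nonzero_val].
HB.instance Definition _ := [Choice of nonzero by <:].

Definition nonzero_one : nonzero := Nonzero (oner_neq0 K).

Definition nonzero_mul (a b : nonzero) : nonzero :=
  Nonzero (mulf_neq0 (nonzeroP a) (nonzeroP b)).

Definition nonzero_inv (a : nonzero) : nonzero :=
  Nonzero (invr_neq0 (nonzeroP a)).

Fact nonzero_mulA : associative nonzero_mul.
Proof. by move=> a b c; apply/val_inj/mulrA. Qed.

Fact nonzero_mul1 : left_id nonzero_one nonzero_mul.
Proof. by move=> a; apply/val_inj/mul1r. Qed.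

Fact nonzero_mulr1 : right_id nonzero_one nonzero_mul.
Proof. by move=> a; apply/val_inj/mulr1. Qed.

Fact nonzero_mulV : left_inverse nonzero_one nonzero_inv nonzero_mul.
Proof. by move=> a; apply/val_inj/mulVf/nonzeroP. Qed.

Fact nonzero_mulrV : right_inverse nonzero_one nonzero_inv nonzero_mul.
Proof. by move=> a; apply/val_inj/mulfV/nonzeroP. Qed.

HB.instance Definition _ := isGroup.Build nonzero
  nonzero_mulA nonzero_mul1 nonzero_mulr1 nonzero_mulV nonzero_mulrV.

End MultiplicativeGroup.

Definition isomorphic_groups (G H : groupType) : Prop :=
  exists f : {multiplicative G -> H}, bijective f.

Section Psi.
Variables (K : fieldType) (q : K).

Local Notation U := (Uq q).

Section PsiMor.
Variables a b : K.

Fact psi_serre1 : serre1 q (a *: e1 q) (b *: e2 q) = 0.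
Proof. by rewrite serre1_scale Uq_serre1 scaler0. Qed.

Fact psi_serre2 : serre2 q (a *: e1 q) (b *: e2 q) = 0.
Proof. by rewrite serre2_scale Uq_serre2 scaler0. Qed.

Definition psi_mor : {lrmorphism U -> U} := Uq_lift psi_serre1 psi_serre2.

Lemma psi_mor_e1 : psi_mor (e1 q) = a *: e1 q.
Proof. exact: Uq_lift_e1. Qed.

Lemma psi_mor_e2 : psi_mor (e2 q) = b *: e2 q.
Proof. exact: Uq_lift_e2. Qed.

End PsiMor.

Fact psi_morK (a b a' b' : K) :
  a' * a = 1 -> b' * b = 1 -> cancel (psi_mor a b) (psi_mor a' b').
Proof.
move=> aK bK; apply: (@Uq_hom_ext _ _ _ (psi_mor a' b' \o psi_mor a b) idfun).
  by rewrite /= psi_mor_e1 linearZ /= psi_mor_e1 scalerA mulrC aK scale1r.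
by rewrite /= psi_mor_e2 linearZ /= psi_mor_e2 scalerA mulrC bK scale1r.
Qed.

Fact psi_bij (a b : nonzero K) : bijective (psi_mor a b).
Proof.
exists (psi_mor (val a)^-1 (val b)^-1); apply: psi_morK;
  by rewrite ?mulVf ?mulfV ?nonzeroP.
Qed.

Definition psi (a b : nonzero K) : algAut U := AlgAut (psi_bij a b).

Lemma psi_e1 a b : psi a b (e1 q) = (a : K) *: e1 q.
Proof. exact: psi_mor_e1. Qed.

Lemma psi_e2 a b : psi a b (e2 q) = (b : K) *: e2 q.
Proof. exact: psi_mor_e2. Qed.

End Psi.

(* Main.v *)
Require Import Defs.
From HB Require Import structures.
From mathcomp Require Import all_boot all_order all_algebra complex.
From mathcomp Require Import boolp classical_sets reals.
From mathcomp Require Import finmap monalg zify ring.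
Set Implicit Arguments.
Unset Strict Implicit.
Unset Printing Implicit Defensive.
Import Order.TTheory GRing.Theory Num.Theory.
Local Open Scope ring_scope.

(* With e3 = e1 e2 - p^2 e2 e1, z = e2 e3 - p^2 e3 e2 and p one of q, 1/q, the
   algebra embeds into the quantum torus X Y = p^-2 Y X over K[z, w], where w is
   the second generator of the centre: e1 -> X, e3 -> Y, and e2 is the Laurent
   polynomial forced by the two commutator identities.  Injectivity comes from a
   spanning set of ordered monomials, as every factor e2 raises the degree in w.

   The one-dimensional representations form two coordinate axes, so an
   automorphism f acts on generators, modulo products of two generators, by a
   diagonal or an antidiagonal matrix; the latter is excluded by a representation
   on strictly upper triangular 4 x 4 matrices.  Hence f(e1) contains X and f(e3)
   contains Y.  For any total order on Z^2, every x times a power of e3 e1 is a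
   combination of monomials in e3, e1 with central coefficients, and their images
   under f have distinct leading exponents.  Applied to x = f^-1(e1), this bounds
   the leading exponent of f(e1) by that of X.  Using an order and its opposite,
   f(e1) is a central multiple of e1, hence a scalar one, and likewise for e3.
   Taking p = q and p = 1/q then determines f(e2 e1), and so f(e2). *)

(** * Additive extension from monomials *)

Section LinearExtension.
Variables (I : choiceType) (G V : zmodType).
Implicit Types (t s : {malg G[I]}) (h : I -> G -> V).

Definition linext h t : V := \sum_(k <- msupp t) h k t@_k.

Lemma linextEw h (E : {fset I}) t :
  (forall k, h k 0 = 0) -> (msupp t `<=` E)%fset ->
  linext h t = \sum_(k <- E) h k t@_k.
Proof.
move=> h0 tE; apply: big_fset_incl => //= k _ kt.
by rewrite mcoeff_outdom.
Qed.

Lemma linextD h t s : (forall k, {morph h k : x y / x + y}) ->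
  linext h (t + s) = linext h t + linext h s.
Proof.
move=> hD; have h0 k : h k 0 = 0.
  by apply: (addrI (h k 0)); rewrite -hD !addr0.
pose E := (msupp t `|` msupp s)%fset.
rewrite !(linextEw (E := E)) ?fsubsetUl ?fsubsetUr ?msuppD_le //.
by rewrite -big_split; apply: eq_bigr => k _; rewrite mcoeffD hD.
Qed.

Lemma linextU h k c : h k 0 = 0 -> linext h << c *g k >> = h k c.
Proof.
move=> h0; rewrite /linext msuppU.
case: eqP => [->|_]; first by rewrite big_seq_fset0 h0.
by rewrite big_seq_fset1 mcoeffUU.
Qed.

Lemma linext0 h : linext h 0 = 0.
Proof. by rewrite /linext msupp0 big_seq_fset0. Qed.

End LinearExtension.

Lemma malg_ind (I : choiceType) (G : zmodType) (P : {malg G[I]} -> Prop) :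
  P 0 -> (forall k c t, P t -> P (<< c *g k >> + t)) -> forall t, P t.
Proof.
move=> P0 PD t; rewrite (monalgE t).
by elim: (enum_fset (msupp t)) => [|k s IHs]; rewrite ?big_nil ?big_cons; auto.
Qed.

(** * The quantum torus over a ring of central polynomials *)

Section QuantumTorus.
Variable K : fieldType.

Local Notation R := {poly {poly K}}.

(* The exponent (i, j) stands for the ordered monomial Y^j X^i, with
   X Y = u Y X.  The two polynomial variables are central. *)
Definition qtorus of nonzero K : Type := {malg R[(int * int)%type]}.

Variable u : nonzero K.

Local Notation T := (qtorus u).

HB.instance Definition _ := GRing.Zmodule.on T.

Implicit Types (r s t : T) (m n k : (int * int)%type) (c d : R).

Fact cst_key : unit. Proof. exact: tt. Qed.
Definition cst := locked_with cst_key (fun x : K => x%:P%:P : R).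
Canonical cst_unlockable := [unlockable fun cst].

Fact cst_is_zmod_morphism : zmod_morphism cst.
Proof. by move=> x y; rewrite [cst]unlock !rmorphB. Qed.

Fact cst_is_monoid_morphism : monoid_morphism cst.
Proof. by split=> [|x y]; rewrite [cst]unlock ?rmorphM. Qed.

HB.instance Definition _ := GRing.isZmodMorphism.Build K R cst cst_is_zmod_morphism.
HB.instance Definition _ := GRing.isMonoidMorphism.Build K R cst cst_is_monoid_morphism.

Lemma cst_inj : injective cst.
Proof. by rewrite [cst]unlock => x y /polyC_inj/polyC_inj. Qed.

Lemma cst_eq0 x : (cst x == 0) = (x == 0).
Proof. by rewrite [cst]unlock !polyC_eq0. Qed.

Lemma cstE x : cst x = x%:P%:P. Proof. by rewrite [cst]unlock. Qed.
Lemma cst_0 : cst 0 = 0. Proof. exact: rmorph0. Qed.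
Lemma cst_1 : cst 1 = 1. Proof. exact: rmorph1. Qed.
Lemma cstB : {morph cst : x y / x - y}. Proof. exact: rmorphB. Qed.
Lemma cstM : {morph cst : x y / x * y}. Proof. exact: rmorphM. Qed.

(** Moving X^(m.1) past Y^(n.2) costs this power of [u]: it is the cocycle of the product of ordered
    monomials. *)
Definition tw m n : K := (u : K) ^ (m.1 * n.2).

Lemma tw_neq0 m n : tw m n != 0.
Proof. by rewrite expfz_neq0 ?nonzeroP. Qed.

Lemma twDl m n k : tw (m + n) k = tw m k * tw n k.
Proof. by rewrite /tw mulrDl expfzDr ?nonzeroP. Qed.

Lemma twDr m n k : tw m (n + k) = tw m n * tw m k.
Proof. by rewrite /tw mulrDr expfzDr ?nonzeroP. Qed.

Lemma tw0l m : tw 0 m = 1.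
Proof. by rewrite /tw mul0r expr0z. Qed.

Lemma tw0r m : tw m 0 = 1.
Proof. by rewrite /tw mulr0 expr0z. Qed.

Fact mon_key : unit. Proof. exact: tt. Qed.
Definition mon := locked_with mon_key (fun m c => << c *g m >> : T).
Canonical mon_unlockable := [unlockable fun mon].
Fact coef_key : unit. Proof. exact: tt. Qed.
Definition coef := locked_with coef_key (fun m (t : T) => t@_m : R).
Canonical coef_unlockable := [unlockable fun coef].

Lemma qcoefE m t : coef m t = mcoeff m t.
Proof. by rewrite [coef]unlock. Qed.
Lemma monE m c : mon m c = mkmalgU m c.
Proof. by rewrite [mon]unlock. Qed.

Fact coef_is_zmod_morphism m : zmod_morphism (coef m).
Proof. by move=> s t; rewrite [coef]unlock; exact: mcoeffB. Qed.
Fact mon_is_zmod_morphism m : zmod_morphism (mon m).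
Proof. by move=> c d; rewrite [mon]unlock; exact: monalgUB. Qed.

HB.instance Definition _ m := GRing.isZmodMorphism.Build T R (coef m)
  (coef_is_zmod_morphism m).
HB.instance Definition _ m := GRing.isZmodMorphism.Build R T (mon m)
  (mon_is_zmod_morphism m).

Lemma mon_0 m : mon m 0 = 0. Proof. exact: raddf0. Qed.
Lemma monD m : {morph mon m : c d / c + d}. Proof. exact: raddfD. Qed.
Lemma monB m : {morph mon m : c d / c - d}. Proof. exact: raddfB. Qed.
Lemma qcoefD m : {morph coef m : s t / s + t}. Proof. exact: raddfD. Qed.
Lemma qcoefN m : {morph coef m : t / - t}. Proof. exact: raddfN. Qed.
Lemma qcoef0 m : coef m 0 = 0. Proof. exact: raddf0. Qed.

Lemma coef_mon m n c : coef n (mon m c) = c *+ (m == n).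
Proof. by rewrite [coef]unlock [mon]unlock; exact: mcoeffU. Qed.

Lemma qtorusP s t : (forall m, coef m s = coef m t) <-> s = t.
Proof. by rewrite [coef]unlock; exact: malgP. Qed.

Lemma qtorus_ind (P : T -> Prop) :
  P 0 -> (forall m c t, P t -> P (mon m c + t)) -> forall t, P t.
Proof. by rewrite [mon]unlock; exact: malg_ind. Qed.

Fact monmul_key : unit. Proof. exact: tt. Qed.
Definition monmul := locked_with monmul_key (fun m c t =>
  linext (fun n d => mon (m + n) (cst (tw m n) * c * d)) t).
Canonical monmul_unlockable := [unlockable fun monmul].

Fact qmul_key : unit. Proof. exact: tt. Qed.
Definition qmul := locked_with qmul_key (fun s t =>
  linext (fun m c => monmul m c t) s).
Canonical qmul_unlockable := [unlockable fun qmul].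

Lemma monmulDr m c s t : monmul m c (s + t) = monmul m c s + monmul m c t.
Proof. by rewrite [monmul]unlock; apply: linextD => n x y; rewrite mulrDr raddfD. Qed.

Lemma monmulDl m c d t : monmul m (c + d) t = monmul m c t + monmul m d t.
Proof.
rewrite [monmul]unlock /linext -big_split; apply: eq_bigr => n _.
by rewrite mulrDr mulrDl raddfD.
Qed.

Lemma monmul_mon m c n d : monmul m c (mon n d) = mon (m + n) (cst (tw m n) * c * d).
Proof.
rewrite [monmul]unlock [X in linext _ X](_ : _ = << d *g n >>); last by rewrite [mon]unlock.
by rewrite linextU // mulr0 raddf0.
Qed.

Lemma monmul0 m c : monmul m c 0 = 0.
Proof. by rewrite [monmul]unlock linext0. Qed.

(** Associativity on monomials: [tw] is multiplicative in each argument, hence a 2-cocycle. *)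
Lemma monmul_mul m c n d t :
  monmul m c (monmul n d t) = monmul (m + n) (cst (tw m n) * c * d) t.
Proof.
elim/qtorus_ind: t => [|k x t IHt]; first by rewrite !monmul0.
rewrite (monmulDr n d) (monmulDr m c) (monmulDr (m + n)) IHt; congr (_ + _).
rewrite !monmul_mon.
rewrite addrA.
rewrite twDl twDr.
rewrite !cstM.
congr mon; ring.
Qed.

Fact qmulDl : left_distributive qmul +%R.
Proof.
by move=> s t r; rewrite [qmul]unlock; apply: linextD => m c d; exact: monmulDl.
Qed.

Fact qmulDr : right_distributive qmul +%R.
Proof.
move=> s t r; rewrite [qmul]unlock /linext -big_split; apply: eq_bigr => m _.
exact: monmulDr.
Qed.

Lemma qmul_mon m c t : qmul (mon m c) t = monmul m c t.
Proof.
rewrite [qmul]unlock [mon]unlock.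
by apply: linextU; apply: (addrI (monmul m 0 t)); rewrite -monmulDl !addr0.
Qed.

Lemma qmul0l t : qmul 0 t = 0.
Proof. by rewrite [qmul]unlock linext0. Qed.

Fact qmulA : associative qmul.
Proof.
move=> r s t; elim/qtorus_ind: r => [|m c r IHr]; first by rewrite !qmul0l.
rewrite !qmulDl IHr; congr (_ + _); rewrite !qmul_mon.
elim/qtorus_ind: s {IHr} => [|n d s IHs]; first by rewrite monmul0 qmul0l monmul0.
rewrite qmulDl !monmulDr qmulDl IHs; congr (_ + _).
by rewrite monmul_mon !qmul_mon monmul_mul.
Qed.

Fact qmul1 : left_id (mon 0 1) qmul.
Proof.
move=> t; rewrite qmul_mon; elim/qtorus_ind: t => [|m c t IHt].
  exact: monmul0.
by rewrite monmulDr IHt monmul_mon add0r tw0l cst_1 !mul1r.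
Qed.

Fact qmulr1 : right_id (mon 0 1) qmul.
Proof.
move=> t; elim/qtorus_ind: t => [|m c t IHt]; first exact: qmul0l.
by rewrite qmulDl IHt qmul_mon monmul_mon addr0 tw0r cst_1 mul1r mulr1.
Qed.

Fact qtorus_nontriv : mon 0 1 != 0.
Proof.
apply/eqP => /(congr1 (coef 0)); rewrite coef_mon qcoef0 eqxx => /eqP.
by rewrite oner_eq0.
Qed.

HB.instance Definition _ := GRing.Zmodule_isNzRing.Build T
  qmulA qmul1 qmulr1 qmulDl qmulDr qtorus_nontriv.

Lemma monM m n c d : mon m c * mon n d = mon (m + n) (cst (tw m n) * c * d).
Proof. by rewrite [LHS]qmul_mon monmul_mon. Qed.

Lemma mon_1 : mon 0 1 = 1.
Proof. by []. Qed.

Lemma coef_monM m c t n : coef n (mon m c * t) = cst (tw m (n - m)) * c * coef (n - m) t.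
Proof.
elim/qtorus_ind: t => [|k x t IHt]; first by rewrite mulr0 !qcoef0 mulr0.
rewrite mulrDr !qcoefD IHt mulrDr monM !coef_mon; congr (_ + _).
rewrite (eq_sym k) subr_eq (addrC k) eq_sym; case: eqP => [->|_]; last by rewrite mulr0.
by rewrite !mulr1n addrAC subrr add0r.
Qed.

Lemma coef_Mmon m c t n : coef n (t * mon m c) = cst (tw (n - m) m) * coef (n - m) t * c.
Proof.
elim/qtorus_ind: t => [|k x t IHt]; first by rewrite mul0r !qcoef0 mulr0 mul0r.
rewrite mulrDl !qcoefD IHt mulrDr mulrDl monM !coef_mon; congr (_ + _).
rewrite (eq_sym k) subr_eq eq_sym; case: eqP => [->|_]; last by rewrite mulr0 mul0r.
by rewrite !mulr1n -addrA subrr addr0.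
Qed.

Lemma qcoefM s t n :
  coef n (s * t) = \sum_(m <- msupp s)
    cst (tw m (n - m)) * coef m s * coef (n - m) t.
Proof.
rewrite [s * t](_ : _ = \sum_(m <- msupp s) mon m (coef m s) * t).
  by rewrite (raddf_sum (coef n)); apply: eq_bigr => m _; rewrite -coef_monM.
transitivity (qmul s t) => //; rewrite [qmul]unlock; apply: eq_bigr => m _.
by rewrite [RHS]qmul_mon [coef]unlock.
Qed.

Lemma qtorusE t : t = \sum_(m <- msupp t) mon m (coef m t).
Proof. by rewrite [coef]unlock [mon]unlock; exact: monalgE. Qed.

Definition qcst (x : K) : T := mon 0 (cst x).

Definition qscale (x : K) t : T := qcst x * t.

Lemma coef_qscale x t m : coef m (qscale x t) = cst x * coef m t.
Proof. by rewrite coef_monM tw0l subr0 cst_1 !mul1r. Qed.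

Fact qscaleA x y t : qscale x (qscale y t) = qscale (x * y) t.
Proof. by apply/qtorusP => m; rewrite !coef_qscale cstM mulrA. Qed.
Fact qscale1 : left_id 1 qscale.
Proof. by move=> t; rewrite /qscale /qcst cst_1 [LHS]mul1r. Qed.
Fact qscaleDr : right_distributive qscale +%R.
Proof. by move=> x s t; rewrite /qscale mulrDr. Qed.
Fact qscaleDl t : {morph qscale^~ t : x y / x + y}.
Proof. by move=> x y; rewrite /qscale /qcst !raddfD /= mulrDl. Qed.

HB.instance Definition _ := GRing.Zmodule_isLmodule.Build K T
  qscaleA qscale1 qscaleDr qscaleDl.

Fact qscaleAl x s t : x *: (s * t) = (x *: s) * t.
Proof. exact: mulrA. Qed.

HB.instance Definition _ := GRing.Lmodule_isLalgebra.Build K T qscaleAl.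

Lemma qcoefZ x t m : coef m (x *: t) = cst x * coef m t.
Proof. exact: coef_qscale. Qed.

Fact qscaleAr x s t : x *: (s * t) = s * (x *: t).
Proof.
suff xC : s * mon 0 (cst x) = mon 0 (cst x) * s.
  by rewrite [x *: t]/(mon 0 (cst x) * t) mulrA xC -mulrA.
apply/qtorusP => m; rewrite coef_monM coef_Mmon tw0l tw0r subr0 cst_1.
by rewrite !mul1r mulrC.
Qed.

HB.instance Definition _ := GRing.Lalgebra_isAlgebra.Build K T qscaleAr.

Lemma scale_mon x m c : x *: mon m c = mon m (cst x * c).
Proof. by apply/qtorusP => n; rewrite qcoefZ !coef_mon mulrnAr. Qed.

Lemma mon0_comm c t : mon 0 c * t = t * mon 0 c.
Proof.
apply/qtorusP => m; rewrite coef_monM coef_Mmon tw0l tw0r subr0 cst_1.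
by rewrite !mul1r mulrC.
Qed.

End QuantumTorus.

(** * The quantum Serre relations as iterated q-commutators *)

Section SerreIdentities.
Variables (K : fieldType) (A : algType K).

Definition qcomm (p : K) (x y : A) : A := x * y - (p ^+ 2) *: (y * x).

Section LinearCombinations.
Variables w1 w2 w3 w4 : A.

Let lc4 (a b c d : K) := a *: w1 + b *: w2 + c *: w3 + d *: w4.

Let lc4D a b c d a' b' c' d' :
  lc4 a b c d + lc4 a' b' c' d' = lc4 (a + a') (b + b') (c + c') (d + d').
Proof.
rewrite /lc4 !scalerDl !addrA -!(addrAC _ (a' *: w1)) -!(addrAC _ (b' *: w2)).
by rewrite -(addrAC _ (c' *: w3)).
Qed.

Let lc4Z k a b c d : k *: lc4 a b c d = lc4 (k * a) (k * b) (k * c) (k * d).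
Proof. by rewrite /lc4 !scalerDr !scalerA. Qed.

Let lc4N a b c d : - lc4 a b c d = lc4 (- a) (- b) (- c) (- d).
Proof. by rewrite -scaleN1r lc4Z !mulN1r. Qed.

Let lc4_1 : w1 = lc4 1 0 0 0. Proof. by rewrite /lc4 !scale0r !addr0 scale1r. Qed.
Let lc4_2 : w2 = lc4 0 1 0 0. Proof. by rewrite /lc4 !scale0r !addr0 add0r scale1r. Qed.
Let lc4_3 : w3 = lc4 0 0 1 0. Proof. by rewrite /lc4 !scale0r !addr0 !add0r scale1r. Qed.
Let lc4_4 : w4 = lc4 0 0 0 1. Proof. by rewrite /lc4 !scale0r !add0r scale1r. Qed.

(** Hiding the combination behind an abstract [L] turns an identity between fixed words into one
    identity of scalars per word, which [field] decides. *)
Lemma lincomb4 : exists L : K -> K -> K -> K -> A,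
  [/\ forall a b c d a' b' c' d',
        L a b c d + L a' b' c' d' = L (a + a') (b + b') (c + c') (d + d'),
      forall k a b c d, k *: L a b c d = L (k * a) (k * b) (k * c) (k * d),
      forall a b c d, - L a b c d = L (- a) (- b) (- c) (- d)
    & [/\ w1 = L 1 0 0 0, w2 = L 0 1 0 0, w3 = L 0 0 1 0 & w4 = L 0 0 0 1]].
Proof.
exists lc4; split; [exact: lc4D|exact: lc4Z|exact: lc4N|split].
- exact: lc4_1.
- exact: lc4_2.
- exact: lc4_3.
- exact: lc4_4.
Qed.

(** The words are x1 x1 x2, x1 x2 x1 and x2 x1 x1; the right side expands x1 x3 - p^-2 x3 x1 for x3
    = x1 x2 - p^2 x2 x1. Only the symmetric q^2 + q^-2 enters, which is why p may be q or its
    inverse. *)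
Lemma serre1_words (p q : K) : p != 0 -> q ^+ 2 + q ^- 2 = p ^+ 2 + p ^- 2 ->
  w1 - (q ^+ 2 + q ^- 2) *: w2 + w3 =
  w1 - p ^+ 2 *: w2 - p ^- 2 *: (w2 - p ^+ 2 *: w3).
Proof.
move=> p0 ->; have [L [LD LZ LN [-> -> -> _]]] := lincomb4.
by rewrite !(LD, LZ, LN); congr L; field.
Qed.

Lemma serre2_words (p q : K) : p != 0 -> q ^+ 2 + q ^- 2 = p ^+ 2 + p ^- 2 ->
  w1 - (q ^+ 2 + 1 + q ^- 2) *: w2 + (q ^+ 2 + 1 + q ^- 2) *: w3 - w4 =
  - p ^- 2 *: (w2 - p ^+ 2 *: w1 - p ^+ 2 *: (w3 - p ^+ 2 *: w2)
     - (w3 - p ^+ 2 *: w2 - p ^+ 2 *: (w4 - p ^+ 2 *: w3))).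
Proof.
move=> p0; rewrite (addrAC (q ^+ 2)) => ->.
have [L [LD LZ LN [-> -> -> ->]]] := lincomb4.
by rewrite !(LD, LZ, LN); congr L; field.
Qed.

End LinearCombinations.

Variables (p q : K) (a1 a2 : A).
Hypotheses (p0 : p != 0) (pq : q ^+ 2 + q ^- 2 = p ^+ 2 + p ^- 2).

Local Notation a3 := (qcomm p a1 a2).
Local Notation az := (qcomm p a2 a3).

(** The first Serre relation thus says that e1 and e3 skew-commute. *)
Lemma serre1E : serre1 q a1 a2 = a1 * a3 - p ^- 2 *: (a3 * a1).
Proof.
rewrite /serre1 /qcomm mulrBl mulrBr -scalerAl -scalerAr !mulrA (serre1_words _ _ _ 0 p0 pq).
by rewrite !expr2 ?mulrA.
Qed.

(** The second Serre relation thus says that z commutes with e2. *)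
Lemma serre2E : serre2 q a1 a2 = - p ^- 2 *: (a2 * az - az * a2).
Proof.
rewrite /serre2 (serre2_words _ _ _ _ p0 pq) /qcomm.
rewrite !(mulrBl, mulrBr) -!(scalerAl, scalerAr) !(mulrBl, mulrBr) -!(scalerAl, scalerAr).
by rewrite !exprS !expr0 !mulr1 !mulrA.
Qed.

End SerreIdentities.

(** * The morphism from U^+ to the quantum torus *)

Section TorusMorphism.
Variables (K : fieldType) (p q : K) (p0 : p != 0).

Definition invsq : nonzero K := Nonzero (invr_neq0 (expf_neq0 2 p0)).

Local Notation T := (qtorus invsq).
Local Notation mon := (mon invsq).

Definition tX : T := mon (1, 0) 1.
Definition tY : T := mon (0, 1) 1.
(** The image of e2. The middle term makes the q-commutator of [tX] with [tE] equal to [tY], the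
    first makes that of [tE] with [tY] equal to z, and the last is killed by both, which leaves its
    central coefficient w free. *)
Definition tE : T :=
  mon (0, -1) (cst (1 - p ^+ 2)^-1 * 'X%:P)
  + mon (-1, 1) (cst (p ^- 2 - p ^+ 2)^-1) + mon (-1, -1) 'X.

Definition not_root_of_unity := forall n : nat, (0 < n)%N -> p ^+ n != 1.

Hypothesis pn : not_root_of_unity.

Lemma subr1sq_neq0 : 1 - p ^+ 2 != 0.
Proof. by rewrite subr_eq0 eq_sym pn. Qed.

Lemma subVsq_neq0 : p ^- 2 - p ^+ 2 != 0.
Proof.
rewrite subr_eq0; apply: contraNneq (pn (n := 4) isT) => /eqP.
rewrite -(inj_eq (mulfI (expf_neq0 2 p0))) mulfV ?expf_neq0 // -exprD.
by rewrite eq_sym.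
Qed.

Lemma qcomm_mon m n c d :
  qcomm p (mon m c) (mon n d) =
  mon (m + n) (cst (tw invsq m n - p ^+ 2 * tw invsq n m) * c * d).
Proof.
rewrite /qcomm !monM scale_mon (addrC n) cstB cstM.
rewrite 2!mulrBl monB; congr (_ - mon _ _).
by rewrite -!mulrA (mulrC d).
Qed.

Let twE i j k l : tw invsq (i, j) (k, l) = (p ^- 2) ^ (i * l).
Proof. by []. Qed.

Lemma qcommDr (A : algType K) (x y z : A) :
  qcomm p x (y + z) = qcomm p x y + qcomm p x z.
Proof. by rewrite /qcomm mulrDr mulrDl scalerDr opprD addrACA. Qed.

Lemma qcommDl (A : algType K) (x y z : A) :
  qcomm p (x + y) z = qcomm p x z + qcomm p y z.
Proof. by rewrite /qcomm mulrDr mulrDl scalerDr opprD addrACA. Qed.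

Lemma qcomm_tX_tE : qcomm p tX tE = tY.
Proof.
rewrite /tE !qcommDr !qcomm_mon !twE.
rewrite ?(mulr0, mul0r, mulrN1, mulN1r, mul1r, mulr1, expr0z, exprN1, expr1z, invrK).
rewrite (subrr (p ^+ 2)) cst_0 !mul0r !mon_0 addr0 add0r -cstM mulfV ?subVsq_neq0 //.
by rewrite cst_1.
Qed.

Lemma qcomm_tE_tY : qcomm p tE tY = mon 0 'X%:P.
Proof.
rewrite /tE !qcommDl !qcomm_mon !twE.
rewrite ?(mulr0, mul0r, mulrN1, mulN1r, mul1r, mulr1, expr0z, exprN1, expr1z, invrK).
rewrite (subrr (p ^+ 2)) cst_0 !mul0r !mon_0 addr0 addr0 mulrA -cstM mulfV ?subr1sq_neq0 //.
by rewrite cst_1 mul1r.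
Qed.

Hypothesis pq : q ^+ 2 + q ^- 2 = p ^+ 2 + p ^- 2.

Lemma tX_tY : tX * tY = p ^- 2 *: (tY * tX).
Proof.
rewrite !monM scale_mon !twE ?(mulr0, mul0r, mulr1, mul1r, expr1z, expr0z).
by rewrite cst_1 mulr1 addrC.
Qed.

Fact torus_serre1 : serre1 q tX tE = 0.
Proof. by rewrite (serre1E _ _ p0 pq) qcomm_tX_tE tX_tY subrr. Qed.

Fact torus_serre2 : serre2 q tX tE = 0.
Proof. by rewrite (serre2E _ _ p0 pq) qcomm_tX_tE qcomm_tE_tY mon0_comm subrr scaler0. Qed.

Definition phi : {lrmorphism Uq q -> T} := Uq_lift torus_serre1 torus_serre2.

Lemma phi_e1 : phi (e1 q) = tX. Proof. exact: Uq_lift_e1. Qed.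
Lemma phi_e2 : phi (e2 q) = tE. Proof. exact: Uq_lift_e2. Qed.

Definition e3 : Uq q := qcomm p (e1 q) (e2 q).
Definition ez : Uq q := qcomm p (e2 q) e3.

Lemma e3E : e3 = qcomm p (e1 q) (e2 q).
Proof. by []. Qed.

Lemma rmorph_qcomm (A B : algType K) (f : {lrmorphism A -> B}) x y :
  f (qcomm p x y) = qcomm p (f x) (f y).
Proof. by rewrite /qcomm rmorphB /= linearZ !rmorphM. Qed.

Lemma phi_e3 : phi e3 = tY.
Proof. by rewrite rmorph_qcomm phi_e1 phi_e2 qcomm_tX_tE. Qed.

Lemma phi_ez : phi ez = mon 0 'X%:P.
Proof. by rewrite rmorph_qcomm phi_e3 phi_e2 qcomm_tE_tY. Qed.

(* The coefficients are those of Y X, X and Y^2 in the image of e3 e1 e2. *)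
Definition ew : Uq q :=
  p ^- 2 *: (e3 * e1 q * e2 q - ((1 - p ^+ 2)^-1 * p ^+ 2) *: (ez * e1 q)
    - ((p ^- 2 - p ^+ 2)^-1 * p ^- 2) *: (e3 * e3)).

Lemma phi_ew : phi ew = mon 0 'X.
Proof.
rewrite linearZ rmorphB rmorphB !rmorphM /= !linearZ !rmorphM /=.
rewrite phi_e1 phi_e2 phi_e3 phi_ez /tX /tY /tE.
rewrite !mulrDr !monM !scalerN !scale_mon !twE.
rewrite ?(mulr0, mul0r, mulrN1, mulN1r, mul1r, mulr1, expr0z, exprN1, expr1z, invrK, cst_1).
set A := mon _ (cst (p ^+ 2) * _); set B := mon _ (cst (p ^- 2) * _).
have -> : mon (0 + (1, 0)) (cst ((1 - p ^+ 2)^-1 * p ^+ 2) * 'X%:P) = A.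
  by rewrite /A mulrA -cstM (mulrC (p ^+ 2)).
have -> : mon ((0, 1) + (0, 1)) (cst ((p ^- 2 - p ^+ 2)^-1 / p ^+ 2)) = B.
  by rewrite /B -cstM (mulrC (p ^- 2)).
rewrite -addrA -opprD (addrC (A + B)) addrK scale_mon mulrA -cstM.
by rewrite mulVf ?expf_neq0 // cst_1 mul1r.
Qed.

End TorusMorphism.

Opaque phi.

(** * Induction on words in U^+ *)

Section UqInduction.
Variables (K : fieldType) (q : K).

(** U^+ is spanned by words, and a word grows by prepending a generator. *)
Lemma Uq_ind_left (P : Uq q -> Prop) :
  P 1 -> (forall x y, P x -> P y -> P (x + y)) -> (forall c x, P x -> P (c *: x)) ->
  (forall x, P x -> P (e1 q * x)) -> (forall x, P x -> P (e2 q * x)) ->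
  forall x, P x.
Proof.
move=> P1 PD PZ Pe1 Pe2 x; have [y ->] := Uq_piP x.
rewrite (monalgE y) raddf_sum.
elim: (enum_fset (msupp y)) => [|m s IHs]; rewrite ?big_nil ?big_cons.
  by rewrite -(scale0r 1); exact: PZ.
apply: PD IHs; have -> : mkmalgU m (mcoeff m y) =
    (mcoeff m y : K) *: (mkmalgU m 1 : free_alg K).
  by rewrite -mul_malgC malgM_def fgmulUU mul1m mulr1.
rewrite /= Uq_pi_scalable; apply: PZ.
case: m => {}s; elim: s => [|i s IHs].
  have -> : FMonom [::] = mone :> {fmonom 'I_2} by apply/val_inj; rewrite /= fm1.
  by rewrite rmorph1.
have -> : mkmalgU (FMonom (i :: s)) 1 = free_gen K i * mkmalgU (FMonom s) 1
    :> free_alg K.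
  rewrite malgM_def fgmulUU mulr1; congr mkmalgU.
  by apply/val_inj; rewrite [RHS]fmM fmU.
rewrite rmorphM /=; case: i => [[|[|//]] lti].
  by rewrite (_ : Ordinal lti = ord0); [exact: Pe1|apply/val_inj].
by rewrite (_ : Ordinal lti = ord_max); [exact: Pe2|apply/val_inj].
Qed.

Lemma Uq_central (c : Uq q) :
  c * e1 q = e1 q * c -> c * e2 q = e2 q * c -> forall x, c * x = x * c.
Proof.
move=> c1 c2; elim/Uq_ind_left => [|x y IHx IHy|a x IHx|x IHx|x IHx].
- by rewrite mulr1 mul1r.
- by rewrite mulrDr mulrDl IHx IHy.
- by rewrite -scalerAr -scalerAl IHx.
- by rewrite mulrA c1 -!mulrA IHx.
- by rewrite mulrA c2 -!mulrA IHx.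
Qed.

End UqInduction.

(** * Centrality of z and w *)

Section QuantumSerreConsequences.
Variables (K : fieldType) (p : K) (A : algType K) (x1 x2 x3 z : A).
Hypotheses (p0 : p != 0) (pn : not_root_of_unity p).
Hypotheses (x13 : x1 * x3 = p ^- 2 *: (x3 * x1))
  (x12 : x1 * x2 = x3 + p ^+ 2 *: (x2 * x1))
  (x23 : x2 * x3 = z + p ^+ 2 *: (x3 * x2)).

(** Moving x1 to the right through x2 x3 and through p^2 x3 x2 gives the same correction x3 x3, and
    the factors p^2 and p^-2 cancel. *)
Lemma root_z_comm1 : z * x1 = x1 * z.
Proof.
have -> : z = x2 * x3 - p ^+ 2 *: (x3 * x2) by rewrite x23 addrK.
rewrite mulrBl mulrBr -!(scalerAl, scalerAr) !mulrA x12 x13 -scalerAl scalerA.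
rewrite mulfV ?expf_neq0 // scale1r mulrDl -[x3 * x1 * x2]mulrA x12 mulrDr opprD.
rewrite addrACA subrr add0r -scalerAl -scalerAr -[x2 * x1 * x3]mulrA x13 -scalerAr.
by rewrite scalerA mulfV ?expf_neq0 // scale1r !mulrA.
Qed.

Hypothesis z2 : z * x2 = x2 * z.

(** Up to the factor p^-2 this is the element [ew]. The computation stays inside the algebra,
    because injectivity of [phi] will rest on the centrality of w: both sides are reduced to at most
    four words, whose coefficients are then compared. *)
Lemma root_w_comm (s := (1 - p ^+ 2)^-1 * p ^+ 2) (t := (p ^- 2 - p ^+ 2)^-1 * p ^- 2)
  (w := x3 * x1 * x2 - s *: (z * x1) - t *: (x3 * x3)) :
  w * x1 = x1 * w /\ w * x2 = x2 * w.
Proof.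
have p1 := subr1sq_neq0 pn; have p2 := subVsq_neq0 p0 pn.
have p4 : 1 + - p ^+ 2 * p ^+ 2 != 0.
  by rewrite mulNr -exprD subr_eq0 eq_sym pn.
have z1 := root_z_comm1.
have x21 : x2 * x1 = p ^- 2 *: (x1 * x2 - x3).
  by rewrite x12 addrAC subrr add0r scalerA mulVf ?expf_neq0 // scale1r.
split; rewrite /w !mulrBl !mulrBr -!scalerAl -!scalerAr.
  have -> : x1 * (x3 * x1 * x2) = p ^- 4 *: (x3 * x3 * x1) + x3 * x1 * x2 * x1.
    rewrite !mulrA x13 -!scalerAl -(mulrA x3 x1 x1) -(mulrA x3 (x1 * x1)) -(mulrA x1).
    rewrite {1}x12 (mulrDr x1) x13 -scalerAr mulrDr scalerDr -!scalerAr !scalerA.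
    by rewrite mulVf ?expf_neq0 // scale1r -invfM -exprD !mulrA.
  have -> : x1 * (x3 * x3) = p ^- 4 *: (x3 * x3 * x1).
    by rewrite mulrA x13 -scalerAl -(mulrA x3 x1) x13 -scalerAr scalerA -invfM -exprD mulrA.
  rewrite (mulrA x1) -z1.
  set w1 := x3 * x1 * x2 * x1; set w2 := x3 * x3 * x1; set w3 := z * x1 * x1.
  have [L [LD LZ LN [-> -> -> _]]] := lincomb4 w1 w2 w3 0.
  rewrite !(LD, LZ, LN); congr L; rewrite /s /t; field; rewrite ?p0 ?p1 ?p4 //.
have z3 : x3 * z = z * x3.
  have -> : x3 = x1 * x2 - p ^+ 2 *: (x2 * x1) by rewrite x12 addrK.
  by rewrite mulrBl mulrBr -!(scalerAl, scalerAr) -!mulrA -z2 -z1 !mulrA -z1 -z2 -!mulrA.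
have z21 : x2 * (z * x1) = p ^- 2 *: (z * x1 * x2 - z * x3).
  by rewrite mulrA -z2 -!mulrA x21 -scalerAr mulrBr.
have -> : x2 * (x3 * x1 * x2) = z * x1 * x2 + x3 * x1 * x2 * x2 - x3 * x3 * x2.
  rewrite !mulrA x23 !mulrDl -addrA -!scalerAl -!mulrA (mulrA x2) x21.
  rewrite -scalerAl mulrBl -!scalerAr scalerA mulfV ?expf_neq0 // scale1r.
  by rewrite mulrBr !mulrA.
have -> : x2 * (x3 * x3) = (1 + p ^+ 2) *: (z * x3) + p ^+ 4 *: (x3 * x3 * x2).
  rewrite mulrA x23 mulrDl -scalerAl -(mulrA x3 x2) x23 mulrDr -scalerAr.
  by rewrite scalerDr scalerA -exprD addrA scalerDl scale1r z3 !mulrA.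
rewrite z21.
set w1 := x3 * x1 * x2 * x2; set w2 := z * x1 * x2; set w3 := z * x3.
set w4 := x3 * x3 * x2.
have [L [LD LZ LN [-> -> -> ->]]] := lincomb4 w1 w2 w3 w4.
rewrite !(LD, LZ, LN); congr L; rewrite /s /t; field; rewrite ?p0 ?p1 ?p4 //.
Qed.

End QuantumSerreConsequences.

(** * Commutation relations in U^+ *)

Section UqRelations.
Variables (K : fieldType) (p q : K).
Hypotheses (p0 : p != 0) (pn : not_root_of_unity p).
Hypothesis pq : q ^+ 2 + q ^- 2 = p ^+ 2 + p ^- 2.

Local Notation e1 := (e1 q).
Local Notation e2 := (e2 q).
Local Notation e3 := (e3 p q).
Local Notation ez := (ez p q).
Local Notation ew := (ew p q).

Lemma e1e3 : e1 * e3 = p ^- 2 *: (e3 * e1).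
Proof. by apply/eqP; rewrite -subr_eq0 -(serre1E _ _ p0 pq) Uq_serre1. Qed.

Lemma e1e2 : e1 * e2 = e3 + p ^+ 2 *: (e2 * e1).
Proof. by rewrite /e3 /qcomm subrK. Qed.

Lemma e2e1 : e2 * e1 = p ^- 2 *: (e1 * e2 - e3).
Proof. by rewrite e1e2 addrAC subrr add0r scalerA mulVf ?expf_neq0 // scale1r. Qed.

Lemma e2e3 : e2 * e3 = ez + p ^+ 2 *: (e3 * e2).
Proof. by rewrite /ez /qcomm subrK. Qed.

Lemma eze2 : ez * e2 = e2 * ez.
Proof.
have := Uq_serre2 q; rewrite (serre2E _ _ p0 pq) => /eqP.
by rewrite scaler_eq0 oppr_eq0 invr_eq0 expf_eq0 (negPf p0) andbF subr_eq0 => /eqP.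
Qed.

Lemma ez_central x : ez * x = x * ez.
Proof. exact: Uq_central (root_z_comm1 p0 e1e3 e1e2 e2e3) eze2 x. Qed.

Lemma ew_central x : ew * x = x * ew.
Proof.
rewrite /ew -scalerAl -scalerAr; congr (_ *: _).
by have [w1 w2] := root_w_comm p0 pn e1e3 e1e2 e2e3 eze2; apply: Uq_central x.
Qed.

End UqRelations.

Opaque e3 ez ew.

Lemma monM0 (K : fieldType) (u : nonzero K) c m d :
  mon u 0 c * mon u m d = mon u m (c * d).
Proof. by rewrite monM add0r tw0l cst_1 mul1r. Qed.

(** * Polynomials in z and w as central elements of U^+ *)

Section CentralCoefficients.
Variables (K : fieldType) (p q : K).
Hypotheses (p0 : p != 0) (pn : not_root_of_unity p).
Hypothesis pq : q ^+ 2 + q ^- 2 = p ^+ 2 + p ^- 2.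

Local Notation R := {poly {poly K}}.
Local Notation U := (Uq q).
Local Notation e1 := (e1 q).
Local Notation e2 := (e2 q).
Local Notation e3 := (e3 p q).
Local Notation ez := (ez p q).
Local Notation ew := (ew p q).
Local Notation T := (qtorus (invsq p0)).
Local Notation mon := (mon (invsq p0)).
Local Notation phi := (phi p0 pn pq).

Let evz : {rmorphism {poly K} -> U} := [the {rmorphism {poly K} -> U} of horner_alg ez].

Fact evz_comm : commr_rmorph evz ew.
Proof. by move=> c; exact: ew_central. Qed.

(** The inner polynomial variable goes to z and the outer one to w, in accordance with [phi_ez] and
    [phi_ew]. *)
Definition evc : {rmorphism R -> U} := horner_morph evz_comm.

(** [P] relates a polynomial to its value, so that one induction yields both centrality and the
    images under [phi]. *)
Lemma evc_ind (P : R -> U -> Prop) :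
  (forall c x d y, P c x -> P d y -> P (c + d) (x + y)) ->
  (forall c x d y, P c x -> P d y -> P (c * d) (x * y)) ->
  P 'X ew -> P 'X%:P ez -> (forall a, P (cst a) a%:A) -> forall c, P c (evc c).
Proof.
move=> PD PM Pw Pz PC.
have Pin c : P c%:P (evz c).
  elim/poly_ind: c => [|c a IHc].
    by rewrite polyC0 rmorph0; have := PC 0; rewrite scale0r cst_0.
  rewrite !rmorphD !rmorphM /= horner_algX horner_algC; apply: PD; first by apply: PM.
  by have := PC a; rewrite cstE.
elim/poly_ind => [|c a IHc].
  by rewrite raddf0; have := PC 0; rewrite scale0r cst_0.
rewrite rmorphD rmorphM /= horner_morphX horner_morphC; apply: PD => //.
by apply: PM.
Qed.

Lemma evc_central c x : evc c * x = x * evc c.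
Proof.
move: c; apply: (evc_ind (P := fun _ y => y * x = x * y)) => [_ x1 _ x2 c1 c2|_ x1 _ x2 c1 c2|||a].
- by rewrite mulrDl mulrDr c1 c2.
- by rewrite -mulrA c2 mulrA c1 mulrA.
- exact: ew_central.
- exact: ez_central.
- by rewrite -scalerAl -scalerAr mul1r mulr1.
Qed.

Lemma phi_evc c : phi (evc c) = mon 0 c.
Proof.
move: c; apply: (evc_ind (P := fun c x => phi x = mon 0 c)) => [c x d y cx dy|c x d y cx dy|||a].
- by rewrite rmorphD /= cx dy monD.
- by rewrite rmorphM /= cx dy monM0.
- exact: phi_ew.
- exact: phi_ez.
- by rewrite linearZ /= rmorph1 -mon_1 scale_mon mulr1.
Qed.

Lemma evc_cst a : evc (cst a) = a%:A.
Proof. by rewrite cstE /= horner_morphC /= horner_algC. Qed.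

Lemma evc_z : evc 'X%:P = ez.
Proof. by rewrite /= horner_morphC /= horner_algX. Qed.

End CentralCoefficients.

Opaque evc.

(** * Ordered monomials spanning U^+ *)

Lemma skew_exp (K : fieldType) (A : algType K) (c : K) (x y : A) i j :
  x * y = c *: (y * x) -> x ^+ i * y ^+ j = c ^+ (i * j) *: (y ^+ j * x ^+ i).
Proof.
move=> xy; have xyj k : x * y ^+ k = c ^+ k *: (y ^+ k * x).
  elim: k => [|k IHk]; first by rewrite !expr0 scale1r mul1r mulr1.
  by rewrite exprS mulrA xy -scalerAl -(mulrA y x) IHk -scalerAr scalerA !exprS !mulrA.
elim: i => [|i IHi]; first by rewrite !expr0 scale1r mul1r mulr1.
rewrite exprS -(mulrA x) IHi -scalerAr (mulrA x) xyj -scalerAl scalerA -exprD.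
by rewrite -mulrA mulSn addnC.
Qed.

(** The analogue of [monM] for any skew-commuting pair; it makes the lift of torus monomials to U^+
    multiplicative. *)
Lemma skew_monomialM (K : fieldType) (A : algType K) (c : K) (a b x y : A) i j k l :
  x * y = c *: (y * x) -> (forall t, b * t = t * b) ->
  (a * y ^+ j * x ^+ i) * (b * y ^+ l * x ^+ k) =
  c ^+ (i * l) *: (a * b * y ^+ (j + l) * x ^+ (i + k)).
Proof.
move=> xy bC; rewrite -(mulrA b) (mulrA _ b) -bC !mulrA bC.
rewrite -(mulrA (a * b * _)) (skew_exp _ _ xy) -scalerAr -scalerAl.
by rewrite !exprD !mulrA.
Qed.

Section PBW.
Variables (K : fieldType) (p q : K).
Hypotheses (p0 : p != 0) (pn : not_root_of_unity p).
Hypothesis pq : q ^+ 2 + q ^- 2 = p ^+ 2 + p ^- 2.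

Local Notation R := {poly {poly K}}.
Local Notation U := (Uq q).
Local Notation e1 := (e1 q).
Local Notation e2 := (e2 q).
Local Notation e3 := (e3 p q).
Local Notation ez := (ez p q).
Local Notation ew := (ew p q).
Local Notation T := (qtorus (invsq p0)).
Local Notation mon := (mon (invsq p0)).
Local Notation phi := (phi p0 pn pq).
Local Notation evc := (evc p0 pn pq).

(** Absolute values only make the term total: the lift is meaningful where both exponents are
    non-negative. *)
Definition nnlift_term (m : (int * int)%type) (c : R) : U :=
  evc c * e3 ^+ `|m.2| * e1 ^+ `|m.1|.

Fact nnlift_key : unit. Proof. exact: tt. Qed.
(* A section of [phi] over the monomials with non-negative exponents. *)
Definition nnlift := locked_with nnlift_key (fun t : T => linext nnlift_term t).
Canonical nnlift_unlockable := [unlockable fun nnlift].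

Lemma nnlift_termD m : {morph nnlift_term m : c d / c + d}.
Proof. by move=> c d; rewrite /nnlift_term rmorphD /= !mulrDl. Qed.

Fact nnlift_is_zmod_morphism : zmod_morphism nnlift.
Proof.
have D s t : nnlift (s + t) = nnlift s + nnlift t.
  by rewrite [nnlift]unlock linextD //; exact: nnlift_termD.
by move=> s t; apply: (addIr (nnlift t)); rewrite -D !subrK.
Qed.

HB.instance Definition _ := GRing.isZmodMorphism.Build T U nnlift nnlift_is_zmod_morphism.

Lemma nnlift_mon m c : nnlift (mon m c) = nnlift_term m c.
Proof.
rewrite [nnlift]unlock [X in linext _ X](_ : _ = << c *g m >>); last by rewrite monE.
by rewrite linextU // /nnlift_term rmorph0 !mul0r.
Qed.

Definition nonneg (m : (int * int)%type) := (0 <= m.1) && (0 <= m.2).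

Definition nnsupp (t : T) := forall m, coef m t != 0 -> nonneg m.

Lemma nnsuppD s t : nnsupp s -> nnsupp t -> nnsupp (s + t).
Proof.
move=> Ps Pt m; rewrite qcoefD; have [s0|/Ps //] := eqVneq (coef m s) 0.
by rewrite s0 add0r; exact: Pt.
Qed.

Lemma nnsupp0 : nnsupp 0.
Proof. by move=> m; rewrite qcoef0 eqxx. Qed.

Lemma nnsupp_mon m c : nonneg m -> nnsupp (mon m c).
Proof. by move=> m0 n; rewrite coef_mon; case: (m =P n) => [<- //|_]; rewrite mulr0n eqxx. Qed.

Lemma nonnegD m n : nonneg m -> nonneg n -> nonneg (m + n).
Proof. by case/andP=> m1 m2 /andP[n1 n2]; apply/andP; rewrite !addr_ge0. Qed.

Lemma nnsupp_ind (P : T -> Prop) :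
  P 0 -> (forall s t, P s -> P t -> P (s + t)) ->
  (forall i j : nat, forall c, P (mon (i%:Z, j%:Z) c)) -> forall t, nnsupp t -> P t.
Proof.
move=> P0 PD Pm t tN; rewrite (qtorusE t) big_seq.
elim/big_ind: _ => // m; rewrite -mcoeff_neq0 => tm.
have /tN : coef m t != 0 by rewrite qcoefE.
by case: m {tm} => [[i|i] [j|j]] //= _; apply: Pm.
Qed.

Lemma nnsuppM s t : nnsupp s -> nnsupp t -> nnsupp (s * t).
Proof.
move=> sN tN; move: s sN; apply: nnsupp_ind => [|s s' IHs IHs'|i j c].
- by rewrite mul0r; exact: nnsupp0.
- by rewrite mulrDl; exact: nnsuppD.
move: t tN; apply: nnsupp_ind => [|s s' IHs IHs'|k l d].
- by rewrite mulr0; exact: nnsupp0.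
- by rewrite mulrDr; exact: nnsuppD.
by rewrite monM; apply/nnsupp_mon/nonnegD.
Qed.

(** e1 and e3 skew-commute with the same factor as X and Y, so ordered monomials multiply alike on
    both sides. *)
Lemma nnliftM s t : nnsupp s -> nnsupp t -> nnlift (s * t) = nnlift s * nnlift t.
Proof.
move=> sN tN; move: s sN; apply: nnsupp_ind => [|s s' IHs IHs'|i j c].
- by rewrite mul0r !raddf0 mul0r.
- by rewrite mulrDl !raddfD /= IHs IHs' mulrDl.
move: t tN; apply: nnsupp_ind => [|s s' IHs IHs'|k l d].
- by rewrite mulr0 !raddf0 mulr0.
- by rewrite mulrDr !raddfD /= IHs IHs' mulrDr.
rewrite monM !nnlift_mon /nnlift_term (skew_monomialM _ _ _ _ _ (e1e3 p0 pq)); last first.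
  exact: evc_central.
rewrite [evc (_ * _)]rmorphM [evc (_ * _)]rmorphM [evc (cst _)]evc_cst mulr_algl -!scalerAl.
by congr (_ *: (_ * _ * _ * _)).
Qed.

(** In effect the span of the e3^j e1^i over K[z, w]: such an element is recovered from its image,
    so [phi] is injective on this subalgebra. *)
Definition nnsub (x : U) : Prop := nnsupp (phi x) /\ nnlift (phi x) = x.

Lemma nnsubD x y : nnsub x -> nnsub y -> nnsub (x + y).
Proof.
case=> [x1 x2] [y1 y2]; split; rewrite rmorphD; first exact: nnsuppD.
by rewrite raddfD /= x2 y2.
Qed.

Lemma nnsubM x y : nnsub x -> nnsub y -> nnsub (x * y).
Proof.
case=> [x1 x2] [y1 y2]; split; rewrite rmorphM; first exact: nnsuppM.
by rewrite nnliftM // x2 y2.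
Qed.

Lemma nnsub_evc c : nnsub (evc c).
Proof.
split; rewrite phi_evc; first exact: nnsupp_mon.
by rewrite nnlift_mon /nnlift_term !expr0 !mulr1.
Qed.

Lemma nnsub_e1 : nnsub e1.
Proof.
split; rewrite phi_e1; first exact: nnsupp_mon.
by rewrite nnlift_mon /nnlift_term expr0 expr1 rmorph1 !mul1r.
Qed.

Lemma nnsub_e3 : nnsub e3.
Proof.
split; rewrite phi_e3; first exact: nnsupp_mon.
by rewrite nnlift_mon /nnlift_term expr0 expr1 rmorph1 mulr1 mul1r.
Qed.

Definition wfree (t : T) := forall m, (size (coef m t) <= 1)%N.

Lemma wfreeD s t : wfree s -> wfree t -> wfree (s + t).
Proof.
move=> Ps Pt m; rewrite qcoefD (leq_trans (size_polyD _ _)) // geq_max.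
by rewrite Ps Pt.
Qed.

Lemma wfreeM s t : wfree s -> wfree t -> wfree (s * t).
Proof.
move=> Ps Pt m; rewrite qcoefM (leq_trans (size_sum _ _ _)) //.
apply/bigmax_leqP_seq => n _ _.
rewrite cstE mul_polyC -scalerAl (leq_trans (size_scale_leq _ _)) //.
rewrite (leq_trans (size_polyMleq _ _)) //.
by have := Ps n; have := Pt (m - n); lia.
Qed.

Lemma wfree_mon m (c : R) : (size c <= 1)%N -> wfree (mon m c).
Proof.
by move=> c1 n; rewrite coef_mon; case: (m =P n) => // _; rewrite mulr0n size_poly0.
Qed.

(** In effect the span of the monomials z^k e3^j e1^i, which serves as coefficient ring for
    polynomials in e2. *)
Definition nnfree (x : U) : Prop := nnsub x /\ wfree (phi x).

Lemma nnfreeD x y : nnfree x -> nnfree y -> nnfree (x + y).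
Proof.
case=> [x1 x2] [y1 y2]; split; first exact: nnsubD.
by rewrite rmorphD; exact: wfreeD.
Qed.

Lemma nnfreeM x y : nnfree x -> nnfree y -> nnfree (x * y).
Proof.
case=> [x1 x2] [y1 y2]; split; first exact: nnsubM.
by rewrite rmorphM; exact: wfreeM.
Qed.

Lemma nnfree_evc (c : R) : (size c <= 1)%N -> nnfree (evc c).
Proof. by split; [exact: nnsub_evc|rewrite phi_evc; exact: wfree_mon]. Qed.

Lemma nnfree0 : nnfree 0.
Proof. by rewrite -(rmorph0 evc); apply: nnfree_evc; rewrite size_poly0. Qed.

Lemma nnfree1 : nnfree 1.
Proof. by rewrite -(rmorph1 evc); apply: nnfree_evc; rewrite size_poly1. Qed.

Lemma nnfree_scale a : nnfree a%:A.
Proof.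
by rewrite -(evc_cst p0 pn pq); apply: nnfree_evc; rewrite cstE size_polyC leq_b1.
Qed.

Lemma nnfree_e1 : nnfree e1.
Proof.
split; first exact: nnsub_e1.
by rewrite phi_e1; apply: wfree_mon; rewrite size_poly1.
Qed.

Lemma nnfree_e3 : nnfree e3.
Proof.
split; first exact: nnsub_e3.
by rewrite phi_e3; apply: wfree_mon; rewrite size_poly1.
Qed.

Lemma nnfreeN x : nnfree x -> nnfree (- x).
Proof. by move=> xF; rewrite -mulN1r -scaleN1r; apply: nnfreeM xF; exact: nnfree_scale. Qed.

Lemma nnfree_ind (P : U -> Prop) :
  (forall x y, P x -> P y -> P (x + y)) ->
  (forall i j (c : R), (size c <= 1)%N -> P (evc c * e3 ^+ j * e1 ^+ i)) ->
  forall x, nnfree x -> P x.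
Proof.
move=> PD Pm x [[xN xE] xF]; rewrite -xE (qtorusE (phi x)) raddf_sum big_seq.
elim/big_ind: _ => //.
  by have := Pm 0 0 0; rewrite rmorph0 !mul0r size_poly0 => /(_ isT).
move=> m; rewrite -mcoeff_neq0 => xm.
have /xN m0 : coef m (phi x) != 0 by rewrite qcoefE.
by rewrite /= nnlift_mon; apply: Pm; exact: xF.
Qed.

(** As in an Ore extension: e2 passes e1, e3 and central coefficients with corrections in the same
    subalgebra, and the property is stable under products and sums. *)
Lemma e2_nnfree x : nnfree x ->
  exists y1 y2, [/\ nnfree y1, nnfree y2 & e2 * x = y1 * e2 + y2].
Proof.
pose Q x := nnfree x /\
  exists y1 y2, [/\ nnfree y1, nnfree y2 & e2 * x = y1 * e2 + y2].
have QM x1 x2 : Q x1 -> Q x2 -> Q (x1 * x2).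
  move=> [x1F [y1 [y2 [y1F y2F xy]]]] [x2F [y3 [y4 [y3F y4F xy']]]].
  split; first exact: nnfreeM.
  exists (y1 * y3), (y1 * y4 + y2 * x2).
  split; [exact: nnfreeM|by apply: nnfreeD; exact: nnfreeM|].
  by rewrite mulrA xy mulrDl -(mulrA y1) xy' mulrDr !mulrA addrA.
have Qe1 : Q e1.
  split; first exact: nnfree_e1.
  exists (p ^- 2 *: e1), (- (p ^- 2 *: e3)); split.
  - by rewrite -mulr_algl; apply: nnfreeM nnfree_e1; exact: nnfree_scale.
  - apply: nnfreeN; rewrite -mulr_algl; apply: nnfreeM nnfree_e3.
    exact: nnfree_scale.
  by rewrite (e2e1 q p0) scalerBr scalerAl.
have Qe3 : Q e3.
  split; first exact: nnfree_e3.
  exists (p ^+ 2 *: e3), ez; split.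
  - by rewrite -mulr_algl; apply: nnfreeM nnfree_e3; exact: nnfree_scale.
  - have -> : ez = evc 'X%:P by rewrite evc_z.
    by apply: nnfree_evc; rewrite size_polyC leq_b1.
  by rewrite e2e3 scalerAl addrC.
have QX y n : Q y -> Q (y ^+ n).
  move=> Qy; elim: n => [|n IHn]; last by rewrite exprS; exact: QM.
  split; first exact: nnfree1.
  exists 1, 0; split; [exact: nnfree1|exact: nnfree0|].
  by rewrite addr0 mul1r mulr1.
suff: nnfree x -> Q x by move=> H /H[].
move: x; apply: nnfree_ind => [x y [x1 [y1 [y2 [y1F y2F xy]]]]|i j c c1].
  move=> [x2 [y3 [y4 [y3F y4F xy']]]]; split; first exact: nnfreeD.
  exists (y1 + y3), (y2 + y4); split; [exact: nnfreeD|exact: nnfreeD|].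
  by rewrite mulrDr xy xy' mulrDl addrACA.
apply: (QM _ _ _ (QX _ i Qe1)); apply: (QM _ _ _ (QX _ j Qe3)).
split; first exact: nnfree_evc.
exists (evc c), 0; split; [exact: nnfree_evc|exact: nnfree0|].
by rewrite addr0 evc_central.
Qed.

(** Horner form of a polynomial in e2 with left coefficients; it lets the injectivity proof remove
    one factor e2 at a time. *)
Inductive pbw : U -> Prop :=
| pbw_nnfree x : nnfree x -> pbw x
| pbw_step y x : pbw y -> nnfree x -> pbw (y * e2 + x).

Lemma pbwD x y : pbw x -> pbw y -> pbw (x + y).
Proof.
move=> px; elim: px y => {x} [x xF y|x d px IHx dF y].
  case=> {y} [y yF|y d py dF]; first by apply/pbw_nnfree/nnfreeD.
  by rewrite addrCA; apply/pbw_step/nnfreeD.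
case=> {y} [y yF|y d' py dF']; first by rewrite -addrA; apply/pbw_step/nnfreeD.
by rewrite addrACA -mulrDl; apply: pbw_step; [exact: IHx|exact: nnfreeD].
Qed.

Lemma pbw_nnfreeM d x : nnfree d -> pbw x -> pbw (d * x).
Proof.
move=> dF; elim=> {x} [x xF|x d' px IHx dF'].
  by apply/pbw_nnfree/nnfreeM.
by rewrite mulrDr mulrA; apply/pbw_step/nnfreeM.
Qed.

Lemma pbw_e2M x : pbw x -> pbw (e2 * x).
Proof.
have base d : nnfree d -> pbw (e2 * d).
  move=> /e2_nnfree[y1 [y2 [y1F y2F ->]]]; apply: pbw_step y2F; exact: pbw_nnfree.
elim=> {x} [x /base //|x d px IHx dF].
rewrite mulrDr mulrA; apply: pbwD; last exact: base.
by rewrite -[_ * e2]addr0; apply: pbw_step IHx nnfree0.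
Qed.

Lemma pbw_all x : pbw x.
Proof.
elim/Uq_ind_left: x => [|x y px py|a x px|x px|x px].
- exact/pbw_nnfree/nnfree1.
- exact: pbwD.
- by rewrite -mulr_algl; apply: pbw_nnfreeM px; exact: nnfree_scale.
- exact: pbw_nnfreeM nnfree_e1 px.
- exact: pbw_e2M.
Qed.

End PBW.

(** * Injectivity of [phi] *)

Lemma seq_argmax (I : eqType) (f : I -> nat) (s : seq I) :
  s != [::] -> exists2 m, m \in s & forall n, n \in s -> (f n <= f m)%N.
Proof.
elim: s => // a s IHs _; have [->|/IHs[m ms mM]] := eqVneq s [::].
  by exists a; rewrite ?inE // => n; rewrite inE => /eqP->.
have [am|/ltnW ma] := leqP (f a) (f m).
  by exists m; rewrite ?inE ?ms ?orbT // => n /predU1P[->|/mM].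
exists a; rewrite ?inE ?eqxx // => n /predU1P[->//|/mM nm].
exact: leq_trans ma.
Qed.

Section Injectivity.
Variables (K : fieldType) (p q : K).
Hypotheses (p0 : p != 0) (pn : not_root_of_unity p).
Hypothesis pq : q ^+ 2 + q ^- 2 = p ^+ 2 + p ^- 2.

Local Notation R := {poly {poly K}}.
Local Notation e2 := (e2 q).
Local Notation T := (qtorus (invsq p0)).
Local Notation phi := (phi p0 pn pq).

(** Take an exponent m where the coefficient of [t] has the largest degree in w. At m - (1, 1) the
    term Y^-1 X^-1 w of [tE] contributes one degree more than the other two terms can, so a positive
    power of w survives. *)
Lemma wfree_tE (t : T) : wfree (t * tE p0) -> t = 0.
Proof.
move=> tF; apply/eqP/negPn/negP => t0.
have /(seq_argmax (fun m => size (coef m t)))[m tm mM] : msupp t != [::] :> seq _.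
  apply: contraNneq t0 => ts; apply/eqP/qtorusP => n; rewrite qcoef0 qcoefE.
  by rewrite mcoeff_outdom //; apply/negP => nt; have : n \in (msupp t : seq _) by []; rewrite ts.
have {}mM n : (size (coef n t) <= size (coef m t))%N.
  have [/mM //|nt] := boolP (n \in msupp t).
  by rewrite qcoefE mcoeff_outdom // size_poly0.
have tm0 : coef m t != 0 by rewrite qcoefE mcoeff_neq0.
have := tF (m + (-1, -1)); rewrite /tE !mulrDr !qcoefD !coef_Mmon addrK.
have sC a (c : R) (d : {poly K}) : (size (cst a * c * d%:P)%R <= size c)%N.
  rewrite mulrAC cstE -polyCM mul_polyC; exact: size_scale_leq.
have sX a : a != 0 -> size (cst a * coef m t * 'X) = (size (coef m t)).+1.
  move=> a0; rewrite cstE mul_polyC size_mulX ?size_scale ?polyC_eq0 //.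
  by rewrite -size_poly_eq0 size_scale ?polyC_eq0 // size_poly_eq0.
rewrite leqNgt => /negP[]; rewrite addrC size_polyDl sX ?tw_neq0 //.
  by rewrite ltnS size_poly_gt0.
rewrite ltnS (leq_trans (size_polyD _ _)) // geq_max; apply/andP; split.
  by rewrite (cstE (_^-1)) -polyCM (leq_trans (sC _ _ _)).
by rewrite (cstE (_^-1)) (leq_trans (sC _ _ _)).
Qed.

(** If [y * e2 + d] has image 0, then [phi y * tE] equals the image of [- d] and is free of w, so
    [phi y] is 0; the induction hypothesis gives y = 0, and [d] is recovered from its image 0. *)
Lemma phi_inj : injective phi.
Proof.
suff phi0 x : phi x = 0 -> x = 0.
  by move=> x y xy; apply/eqP; rewrite -subr_eq0 (phi0 (x - y)) // rmorphB /= xy subrr.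
elim: (pbw_all p0 pn pq x) => {x} [x [[_ xE] _]|y d py IHy [[_ dE] dF]].
  by move=> x0; rewrite -xE x0 raddf0.
rewrite rmorphD rmorphM /= phi_e2 => yd.
have y0 : phi y = 0.
  apply: wfree_tE => m; have -> : phi y * tE p0 = phi (- d).
    by apply/eqP; rewrite rmorphN /= -addr_eq0 yd.
  by rewrite rmorphN /= qcoefN size_polyN.
have d0 : phi d = 0 by rewrite -yd y0 mul0r add0r.
by rewrite IHy // mul0r add0r -dE d0 raddf0.
Qed.

End Injectivity.

(* The positive cone of a total order compatible with addition. *)
Record total_cone (V : zmodType) (P : pred V) : Prop := TotalCone {
  cone0 : ~~ P 0;
  coneD : forall m n, P m -> P n -> P (m + n);
  cone_total : forall m, m != 0 -> P m || P (- m) }.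

(** * Total orders given by their positive cones *)

Section Cone.
Variables (V : zmodType) (P : pred V).
Hypothesis PC : total_cone P.

Definition weak_cone m := (m == 0) || P m.

Lemma weak_cone0 : weak_cone 0.
Proof. by rewrite /weak_cone eqxx. Qed.

Lemma weak_coneD m n : weak_cone m -> weak_cone n -> weak_cone (m + n).
Proof.
case/predU1P=> [->|Pm]; first by rewrite add0r.
case/predU1P=> [->|Pn]; first by rewrite addr0 /weak_cone Pm orbT.
by rewrite /weak_cone coneD // orbT.
Qed.

Lemma coneN m : P m -> ~~ P (- m).
Proof. by move=> Pm; apply: contra (cone0 PC) => /(coneD PC Pm); rewrite subrr. Qed.

Lemma weak_cone_anti m : weak_cone m -> weak_cone (- m) -> m = 0.
Proof.
case/predU1P=> [//|Pm]; case/predU1P => [/eqP|]; first by rewrite oppr_eq0 => /eqP.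
by rewrite (negPf (coneN Pm)).
Qed.

Lemma weak_cone_total m : weak_cone m || weak_cone (- m).
Proof.
rewrite /weak_cone; have [->|/(cone_total PC)/orP[]->] := eqVneq m 0; first by [].
  by rewrite orbT.
by rewrite !orbT.
Qed.

Lemma cone_argmax (I : eqType) (g : I -> V) (s : seq I) :
  s != [::] -> exists2 m, m \in s & forall n, n \in s -> weak_cone (g m - g n).
Proof.
elim: s => // a s IHs _; have [->|/IHs[m ms mM]] := eqVneq s [::].
  by exists a; rewrite ?inE // => n; rewrite inE => /eqP->; rewrite subrr weak_cone0.
have /orP[am|ma] := weak_cone_total (g m - g a).
  by exists m; rewrite ?inE ?ms ?orbT // => n /predU1P[->|/mM].
exists a; rewrite ?inE ?eqxx // => n /predU1P[->|/mM nm]; first by rewrite subrr weak_cone0.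
by rewrite -(subrK (g m) (g a)) -addrA -opprB; apply: weak_coneD.
Qed.

End Cone.

(** * Leading exponents in the quantum torus *)

Section Leads.
Variables (K : fieldType) (u : nonzero K) (P : pred (int * int)%type).
Hypothesis PC : total_cone P.

Local Notation T := (qtorus u).
Implicit Types (s t : T) (m n : (int * int)%type).

Definition lead t m := coef m t != 0 /\ forall n, coef n t != 0 -> weak_cone P (m - n).

Lemma lead_ex t : t != 0 -> exists m, lead t m.
Proof.
move=> t0; have : msupp t != [::] :> seq _.
  apply: contraNneq t0 => ts; apply/eqP/qtorusP => n; rewrite qcoef0 qcoefE.
  by rewrite mcoeff_outdom //; apply/negP => nt; have : n \in (msupp t : seq _) by []; rewrite ts.
case/(cone_argmax PC id) => m tm mM; exists m; split; first by rewrite qcoefE mcoeff_neq0.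
by move=> n; rewrite qcoefE mcoeff_neq0; exact: mM.
Qed.

Lemma lead_mon m (c : {poly {poly K}}) : c != 0 -> lead (mon u m c) m.
Proof.
move=> c0; split; first by rewrite coef_mon eqxx.
move=> n; rewrite coef_mon; case: (m =P n) => [<- _|_]; first by rewrite subrr weak_cone0.
by rewrite mulr0n eqxx.
Qed.

(** Exponents bounded by m and n add up to m + n only if they equal m and n, so a single term of the
    convolution survives. *)
Lemma coef_leadM s t m n : lead s m -> lead t n ->
  coef (m + n) (s * t) = cst (tw u m n) * coef m s * coef n t.
Proof.
case=> m0 mM [n0 nM]; rewrite qcoefM (bigD1_seq m) ?fset_uniq //=; last first.
  by rewrite -mcoeff_neq0 -qcoefE.
rewrite [m + n]addrC addrK big1 ?addr0 // => k km.
have [->|k0] := eqVneq (coef k s) 0; first by rewrite mulr0 mul0r.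
have [->|/nM] := eqVneq (coef (n + m - k) t) 0; first by rewrite mulr0.
rewrite opprB addrCA opprD (addrA n) subrr add0r => km'.
case/eqP: km; apply/eqP; rewrite -subr_eq0; apply/eqP.
by apply: (weak_cone_anti PC km'); rewrite opprB; exact: mM.
Qed.

Lemma leadM s t m n : lead s m -> lead t n -> lead (s * t) (m + n).
Proof.
move=> sm tn; split.
  by rewrite coef_leadM // !mulf_neq0 ?cst_eq0 ?tw_neq0 //; [case: sm|case: tn].
move=> l; rewrite qcoefM => l0.
have [k /andP[k0 kl0]] : exists k, (coef k s != 0) && (coef (l - k) t != 0).
  apply/not_existsP => H; case/eqP: l0; rewrite big1 // => k _.
  by apply/eqP; rewrite mulf_eq0 mulf_eq0; have /negP := H k;
     rewrite negb_and !negbK => /orP[]->; rewrite ?orbT.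
have -> : m + n - l = (m - k) + (n - (l - k)) by rewrite opprB addrACA addKr.
by apply: weak_coneD => //; [case: sm => _; exact|case: tn => _; exact].
Qed.

Lemma lead1 : lead 1 0.
Proof. by rewrite -mon_1; apply/lead_mon/oner_neq0. Qed.

Lemma leadX t m k : lead t m -> lead (t ^+ k) (m *+ k).
Proof.
move=> tm; elim: k => [|k IHk]; first exact: lead1.
by rewrite exprS mulrS; exact: leadM.
Qed.

(* Terms with distinct leading exponents cannot cancel. *)
Lemma lead_sum (I : eqType) (s : seq I) (F : I -> T) l L :
  uniq s -> {in s, forall i, lead (F i) (l i)} -> {in s &, injective l} ->
  lead (\sum_(i <- s) F i) L -> {in s, forall i, weak_cone P (L - l i)}.
Proof.
move=> us Fl linj [_ LM] i si.
have [j sj jM] : exists2 j, j \in s & forall k, k \in s -> weak_cone P (l j - l k).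
  by apply: cone_argmax => //; apply: contraTneq si => ->.
rewrite -(subrK (l j) L) -addrA; apply: weak_coneD => //; last exact: jM.
apply: LM; rewrite raddf_sum (bigD1_seq j) //= big1_seq ?addr0; first by case: (Fl j sj).
move=> k /andP[kj sk]; apply/eqP/negPn/negP => k0.
have lkj : l k - l j = 0.
  apply: (weak_cone_anti PC); last by rewrite opprB; exact: jM.
  by case: (Fl k sk) => _; exact.
case/eqP: kj; apply: linj => //; apply/eqP.
by rewrite -subr_eq0 lkj.
Qed.

End Leads.

Definition lex_cone : pred (int * int)%type :=
  fun m => (0 < m.1) || ((m.1 == 0) && (0 < m.2)).

Lemma lex_total_cone : total_cone lex_cone.
Proof.
split=> // [[m1 m2] [n1 n2]|[m1 m2]]; rewrite /lex_cone /=; first by lia.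
by rewrite -pair_eqE /= negb_and; lia.
Qed.

Lemma total_cone_opp (V : zmodType) (P : pred V) :
  total_cone P -> total_cone (fun m => P (- m)).
Proof.
move=> PC; split=> [|m n Pm Pn|m m0]; first by rewrite oppr0 cone0.
  by rewrite opprD; exact: coneD.
by apply: cone_total; rewrite ?oppr_eq0.
Qed.

(** * Leading exponents under an automorphism *)

Section Rigidity.
Variables (K : fieldType) (p q : K).
Hypotheses (p0 : p != 0) (pn : not_root_of_unity p).
Hypothesis pq : q ^+ 2 + q ^- 2 = p ^+ 2 + p ^- 2.

Local Notation R := {poly {poly K}}.
Local Notation U := (Uq q).
Local Notation e1 := (e1 q).
Local Notation e2 := (e2 q).
Local Notation e3 := (e3 p q).
Local Notation T := (qtorus (invsq p0)).
Local Notation tw := (tw (invsq p0)).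
Local Notation mon := (mon (invsq p0)).
Local Notation phi := (phi p0 pn pq).
Local Notation nnlift := (@nnlift K p q p0 pn pq).
Local Notation evc := (evc p0 pn pq).

Lemma invsq_exp_eq1 (k : int) : (p ^- 2) ^ k = 1 -> k = 0.
Proof.
have H n : (p ^- 2) ^+ n = 1 -> n = 0%N.
  rewrite exprVn -exprM => /eqP; rewrite invr_eq1; case: n => // n.
  by rewrite (negPf (pn _)).
case: k => n; first by move=> /H ->.
by rewrite NegzE -[LHS]invr_expz => /eqP; rewrite invr_eq1 => /eqP/H.
Qed.

(** At an exponent m of [t], commuting with X forces p^(-2 m.2) = 1 and commuting with Y forces
    p^(-2 m.1) = 1, while p^-2 has infinite order. *)
Lemma torus_central (t : T) :
  t * tX p0 = tX p0 * t -> t * tY p0 = tY p0 * t -> t = mon 0 (coef 0 t).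
Proof.
move=> tX_t tY_t; apply/qtorusP => m; rewrite coef_mon eq_sym.
case: (m =P 0) => [-> //|m0]; rewrite mulr0n; apply/eqP/negPn/negP => tm.
have H n : t * mon n 1 = mon n 1 * t -> tw m n = tw n m.
  move/(congr1 (coef (n + m))); rewrite coef_monM coef_Mmon [n + m]addrC addrK mulr1.
  by rewrite mulr1 => /(mulIf tm)/(@cst_inj K).
have m2 : m.2 = 0.
  have := H _ tX_t; rewrite /tw /= mulr0 expr0z mul1r => /esym.
  exact: invsq_exp_eq1.
have m1 : m.1 = 0.
  have := H _ tY_t; rewrite /tw /= mul0r expr0z mulr1.
  exact: invsq_exp_eq1.
by apply: m0; case: m m1 m2 {tm H} => /= ? ? -> ->.
Qed.

Lemma tX_exp i : tX p0 ^+ i = mon (i%:Z, 0) 1.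
Proof.
elim: i => [|i IHi]; first exact: mon_1.
rewrite exprS IHi monM /tw mulr0 expr0z cst_1 !mulr1; rewrite intS.
by [].
Qed.

Lemma tY_exp j : tY p0 ^+ j = mon (0, j%:Z) 1.
Proof.
elim: j => [|j IHj]; first exact: mon_1.
rewrite exprS IHj monM /tw mul0r expr0z cst_1 !mulr1 intS.
by [].
Qed.

(** Injectivity of [phi] makes the second half of [nnsub] automatic. *)
Lemma nnsubP x : nnsupp (phi x) -> nnlift (phi x) = x.
Proof.
suff phi_nnlift (t : T) : nnsupp t -> phi (nnlift t) = t.
  by move=> xN; apply: (@phi_inj K p q p0 pn pq); rewrite phi_nnlift.
move: t; apply: nnsupp_ind => [|s t IHs IHt|i j c].
- by rewrite !raddf0.
- by rewrite !raddfD /= IHs IHt.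
rewrite nnlift_mon /nnlift_term !rmorphM !rmorphXn /=.
rewrite [phi (evc _)]phi_evc [phi e3]phi_e3 [phi e1]phi_e1 tX_exp tY_exp /= monM0 mulr1.
rewrite monM /tw mul0r expr0z cst_1 mul1r mulr1.
by rewrite [(0, _) + _](_ : _ = (0 + i%:Z, j%:Z + 0)%R) // add0r addr0.
Qed.

Section Automorphism.
Variables f g : {lrmorphism U -> U}.
Hypotheses (fK : cancel f g) (gK : cancel g f).

Let F x := phi (f x).

Lemma phi_aut_inj : injective F.
Proof. by move=> x y Fxy; apply: (can_inj fK); exact: phi_inj Fxy. Qed.

(** An automorphism preserves the centre, and an image commuting with X and Y has exponent 0 by
    [torus_central]; injectivity keeps it non-zero. *)
Lemma phi_aut_evc c : exists r : R, F (evc c) = mon 0 r /\ (c != 0 -> r != 0).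
Proof.
have C y : F (evc c) * phi y = phi y * F (evc c).
  by rewrite -(gK y) -!rmorphM evc_central.
exists (coef 0 (F (evc c))); split.
  by apply: torus_central; [rewrite -(phi_e1 p0 pn pq)|rewrite -(phi_e3 p0 pn pq)].
apply: contraNneq => c0; have Fc : F (evc c) = 0.
  rewrite [LHS]torus_central ?c0 ?mon_0 //.
    by rewrite -(phi_e1 p0 pn pq).
  by rewrite -(phi_e3 p0 pn pq).
have : evc c = 0 by apply: phi_aut_inj; rewrite Fc /F !rmorph0.
move/(congr1 phi); rewrite phi_evc rmorph0 => /(congr1 (coef 0)).
by rewrite coef_mon eqxx qcoef0 mulr1n => ->.
Qed.

Lemma phi_aut_skew : F e1 * F e3 = p ^- 2 *: (F e3 * F e1).
Proof.
transitivity (phi (f (e1 * e3))); first by rewrite !rmorphM.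
by rewrite (e1e3 p0 pq) [f _]linearZ [LHS]linearZ /= !rmorphM.
Qed.

Section Leads.
Variables (P : pred (int * int)%type) (al be : (int * int)%type).
Hypotheses (PC : total_cone P) (lead1 : lead P (F e1) al) (lead3 : lead P (F e3) be).

(** Compare the leading coefficients in the skew-commutation of [F e1] and [F e3]: the two twists
    differ by p^-2 to the power of this determinant, and p^-2 has infinite order. *)
Lemma lead_det : al.1 * be.2 - be.1 * al.2 = 1.
Proof.
have := phi_aut_skew => /(congr1 (coef (al + be))).
rewrite (coef_leadM PC lead1 lead3) qcoefZ addrC (coef_leadM PC lead3 lead1).
rewrite !mulrA -cstM [X in X = _]mulrAC.
have a0 : coef al (F e1) != 0 by case: lead1.
have b0 : coef be (F e3) != 0 by case: lead3.
move/(mulIf a0)/(mulIf b0)/(@cst_inj K); rewrite /tw /= => H.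
apply/eqP; rewrite -subr_eq0; apply/eqP; apply: invsq_exp_eq1.
rewrite -addrA expfzDr ?invr_neq0 ?expf_neq0 // H -opprD -invr_expz addrC.
by rewrite expfzDr ?invr_neq0 ?expf_neq0 // expr1z mulfV // mulf_neq0 ?expfz_neq0
  ?invr_neq0 ?expf_neq0.
Qed.

(** Cramer's rule with determinant 1. *)
Lemma lead_comb_inj (i j i' j' : nat) :
  al *+ i + be *+ j = al *+ i' + be *+ j' -> i = i' /\ j = j'.
Proof.
move: lead_det; case: al be => [a1 a2] [b1 b2] /= det E.
have E1 : a1 *+ i + b1 *+ j = a1 *+ i' + b1 *+ j'.
  by have := congr1 fst E; rewrite !raddfD /= !raddfMn.
have E2 : a2 *+ i + b2 *+ j = a2 *+ i' + b2 *+ j'.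
  by have := congr1 snd E; rewrite !raddfD /= !raddfMn.
have hM (a : int) (n : nat) : a *+ n = a * n%:Z by rewrite -mulr_natr natz.
move: E1 E2; rewrite !hM => E1 E2.
split.
  suff: (i%:Z - i'%:Z) * (a1 * b2 - b1 * a2) = 0 by rewrite det mulr1; lia.
  have -> : (i%:Z - i'%:Z) * (a1 * b2 - b1 * a2) =
     (a1 * i + b1 * j - (a1 * i' + b1 * j')) * b2
     - (a2 * i + b2 * j - (a2 * i' + b2 * j')) * b1 by ring.
  by rewrite E1 E2 !subrr !mul0r subrr.
suff: (j%:Z - j'%:Z) * (a1 * b2 - b1 * a2) = 0 by rewrite det mulr1; lia.
have -> : (j%:Z - j'%:Z) * (a1 * b2 - b1 * a2) =
     (a2 * i + b2 * j - (a2 * i' + b2 * j')) * a1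
     - (a1 * i + b1 * j - (a1 * i' + b1 * j')) * a2 by ring.
by rewrite E1 E2 !subrr !mul0r subrr.
Qed.

Lemma nnsupp_shift (t : T) : exists n : nat, nnsupp (mon (n%:Z, n%:Z) 1 * t).
Proof.
(* This bounds the absolute value of both coordinates of every exponent of [t]. *)
exists (\max_(m <- msupp t) (`|m.1| + `|m.2|))%N => m; rewrite coef_monM mulr1.
set n := (\max_(_ <- _) _)%N; rewrite mulf_eq0 cst_eq0 (negPf (tw_neq0 _ _ _)) /=.
rewrite qcoefE mcoeff_neq0 => tm.
have /(_ isT) := @leq_bigmax_seq _ _ xpredT (fun k : (int * int)%type => (`|k.1| + `|k.2|)%N) _ tm.
rewrite -/n.
by rewrite /nonneg; case: (m) => [m1 m2] /=; lia.
Qed.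

(* Multiplying by [e3 ^+ n * e1 ^+ n] turns [x] into a combination of the
   monomials [e3 ^+ j * e1 ^+ i] with central coefficients, whose images have
   distinct leading exponents. *)
Lemma lead_bound x m L : coef m (phi x) != 0 -> lead P (F x) L ->
  weak_cone P (L - (al *~ m.1 + be *~ m.2)).
Proof.
move=> xm xL; have [n nN] := nnsupp_shift (phi x).
pose t := mon (n%:Z, n%:Z) 1 * phi x.
have tE : phi (e3 ^+ n * e1 ^+ n * x) = t.
  rewrite !rmorphM !rmorphXn /= [phi e3]phi_e3 [phi e1]phi_e1 tX_exp tY_exp monM.
  rewrite /tw mul0r expr0z cst_1 !mul1r /t; congr (mon _ _ * _).
  by rewrite [(0, _) + _](_ : _ = (0 + n%:Z, n%:Z + 0)%R) // add0r addr0.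
have xE : e3 ^+ n * e1 ^+ n * x = nnlift t by rewrite -tE nnsubP // tE.
pose l (k : int * int) := al *+ `|k.1| + be *+ `|k.2|.
have FE : F e3 ^+ n * F e1 ^+ n * F x =
    \sum_(k <- msupp t) F (nnlift (mon k (coef k t))).
  transitivity (F (nnlift t)); first by rewrite -xE /F !rmorphM !rmorphXn.
  rewrite {1}(qtorusE t) raddf_sum.
  transitivity (phi (f (\sum_(k <- msupp t) nnlift (mon k (coef k t))))) => //.
  by rewrite !raddf_sum.
have tN k : k \in msupp t -> nonneg k by rewrite -mcoeff_neq0 -qcoefE => /nN.
have Fl : {in msupp t, forall k, lead P (F (nnlift (mon k (coef k t)))) (l k)}.
  move=> k tk; rewrite nnlift_mon /nnlift_term.
  have -> c i j : F (evc c * e3 ^+ j * e1 ^+ i) = F (evc c) * F e3 ^+ j * F e1 ^+ i.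
    by rewrite /F !rmorphM !rmorphXn.
  have [r [-> r0]] := phi_aut_evc (coef k t).
  rewrite /l addrC -[X in lead _ _ (X + _)]add0r; apply: (leadM PC); last exact: leadX.
  apply: (leadM PC); last exact: leadX.
  by apply/lead_mon/r0; rewrite qcoefE mcoeff_neq0.
have linj : {in msupp t &, injective l}.
  move=> k k' /tN + /tN + /lead_comb_inj[]; case: k k' => [k1 k2] [k1' k2'] /=.
  by move=> /andP[/= ? ?] /andP[/= ? ?] ? ?; congr (_, _); lia.
have FL : lead P (\sum_(k <- msupp t) F (nnlift (mon k (coef k t)))) (be *+ n + al *+ n + L).
  by rewrite -FE; apply: (leadM PC) xL; apply: (leadM PC); exact: leadX.
(* The exponent m shifted by (n, n) occurs in [t]. The bound for its term, after removing
   [al *+ n + be *+ n] on both sides, is the claim. *)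
have tm : (n%:Z, n%:Z) + m \in msupp t.
  rewrite -mcoeff_neq0 -qcoefE coef_monM [_ + m]addrC addrK mulr1 mulf_neq0 //.
  by rewrite cst_eq0 tw_neq0.
have := lead_sum PC (fset_uniq _) Fl linj FL tm; have /andP[] := tN _ tm.
rewrite /l; case: (m) => [m1 m2]; rewrite [fst _]/(n%:Z + m1) [snd _]/(n%:Z + m2).
move=> k1 k2; rewrite !pmulrn !gez0_abs // !mulrzDr (addrC (be *~ _) (al *~ _)).
by rewrite addrACA opprD addrA (addrC (_ + _) L) addrK.
Qed.

End Leads.
End Automorphism.
End Rigidity.

(** An exponent that is both the largest and the smallest is the only one. *)
Lemma lead_both (K : fieldType) (u : nonzero K) (P : pred (int * int)%type) t m :
  total_cone P -> @lead K u P t m -> lead (fun n => P (- n)) t m ->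
  t = mon u m (coef m t).
Proof.
move=> PC [_ m1] [_ m2]; apply/qtorusP => n; rewrite coef_mon.
case: (m =P n) => [-> //|mn]; rewrite mulr0n; apply/eqP/negPn/negP => n0.
case: mn; apply/eqP; rewrite -subr_eq0; apply/eqP.
apply: (weak_cone_anti PC (m1 _ n0)); have := m2 _ n0; rewrite /weak_cone.
by rewrite oppr_eq0.
Qed.

Lemma poly2_unit (K : fieldType) (r s : {poly {poly K}}) :
  r * s = 1 -> exists2 a : K, a != 0 & s = cst a.
Proof.
move=> rs; have : s \is a GRing.unit by apply/unitrP; exists r; rewrite [s * r]mulrC rs.
rewrite poly_unitE => /andP[/size_poly1P[s0 s0N ->]]; rewrite coefC eqxx.
rewrite poly_unitE => /andP[/size_poly1P[a a0 ->] _].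
by exists a; rewrite ?cstE.
Qed.

(** * Rigidity of the images of e1 and e3 *)

Section RigidityOfRoots.
Variables (K : fieldType) (p q : K).
Hypotheses (p0 : p != 0) (pn : not_root_of_unity p).
Hypothesis pq : q ^+ 2 + q ^- 2 = p ^+ 2 + p ^- 2.

Local Notation U := (Uq q).
Local Notation e1 := (e1 q).
Local Notation e3 := (e3 p q).
Local Notation mon := (mon (invsq p0)).
Local Notation phi := (phi p0 pn pq).
Local Notation evc := (evc p0 pn pq).

(** The information on linear parts that the leading term argument takes as input, for an
    automorphism and its inverse. *)
Definition has_root_terms (h : U -> U) :=
  coef (1, 0) (phi (h e1)) != 0 /\ coef (0, 1) (phi (h e3)) != 0.

(** X occurs in g(e1) and f(g(e1)) = e1, so [lead_bound] bounds the leading exponent of f(e1) by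
    that of X; conversely X occurs in f(e1). The same holds for e3 and Y. *)
Lemma lead_roots (P : pred (int * int)%type) (f g : {lrmorphism U -> U}) :
  total_cone P -> cancel f g -> cancel g f -> has_root_terms f -> has_root_terms g ->
  lead P (phi (f e1)) (1, 0) /\ lead P (phi (f e3)) (0, 1).
Proof.
move=> PC fK gK [f1 f3] [g1 g3].
have nz (m : (int * int)%type) (t : qtorus (invsq p0)) : coef m t != 0 -> t != 0.
  by apply: contraNneq => ->; rewrite qcoef0.
have [al al1] := lead_ex PC (nz _ _ f1); have [be be3] := lead_ex PC (nz _ _ f3).
have lX : lead P (tX p0) (1, 0) by exact/lead_mon/oner_neq0.
have lY : lead P (tY p0) (0, 1) by exact/lead_mon/oner_neq0.
have := @lead_bound _ _ _ p0 pn pq _ _ fK gK _ _ _ PC al1 be3 _ _ _ g1.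
have := @lead_bound _ _ _ p0 pn pq _ _ fK gK _ _ _ PC al1 be3 _ _ _ g3.
rewrite !gK phi_e1 phi_e3 => /(_ _ lY) + /(_ _ lX).
rewrite /= !mulr0z !mulr1z add0r addr0 => be1 al1'.
have -> : (1, 0) = al :> (int * int)%type.
  by apply/eqP; rewrite -subr_eq0; apply/eqP/(weak_cone_anti PC) => //;
    rewrite opprB; case: al1 => _; exact.
have -> : (0, 1) = be :> (int * int)%type.
  by apply/eqP; rewrite -subr_eq0; apply/eqP/(weak_cone_anti PC) => //;
    rewrite opprB; case: be3 => _; exact.
by [].
Qed.

Lemma central_multiple (h : {lrmorphism U -> U}) x m c :
  phi x = mon m 1 -> phi (h x) = mon m c -> h x = evc c * x.
Proof.
move=> xE hE; apply: (@phi_inj K p q p0 pn pq).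
by rewrite hE rmorphM /= phi_evc xE monM0 mulr1.
Qed.

(** f and g multiply x by central polynomials c and d. Applying f to g(x) = d x gives f(d) c = 1,
    and a unit among the polynomials in z and w is a scalar. *)
Lemma scalar_multiple (f g : {lrmorphism U -> U}) x m c d :
  cancel f g -> cancel g f -> phi x = mon m 1 ->
  phi (f x) = mon m c -> phi (g x) = mon m d ->
  exists2 a : K, a != 0 & f x = a *: x.
Proof.
move=> fK gK xE fE gE.
have [r [rE _]] := phi_aut_evc p0 pn pq fK gK d.
have fx := central_multiple xE fE; have gx := central_multiple xE gE.
have : phi (f (g x)) = mon m (r * c).
  by rewrite gx rmorphM rmorphM /= rE fE monM0.
rewrite gK xE => /(congr1 (coef m)); rewrite !coef_mon eqxx !mulr1n => /esym/poly2_unit[a a0 cE].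
by exists a; rewrite // fx cE evc_cst mulr_algl.
Qed.

Lemma rigidity (f g : {lrmorphism U -> U}) :
  cancel f g -> cancel g f -> has_root_terms f -> has_root_terms g ->
  (exists2 a : K, a != 0 & f e1 = a *: e1) /\ (exists2 a : K, a != 0 & f e3 = a *: e3).
Proof.
(* The lexicographic order and its opposite together reduce each image to a single monomial. *)
move=> fK gK fr gr; have PC := lex_total_cone; have QC := total_cone_opp PC.
have [f1 f3] := lead_roots PC fK gK fr gr; have [f1' f3'] := lead_roots QC fK gK fr gr.
have [g1 g3] := lead_roots PC gK fK gr fr; have [g1' g3'] := lead_roots QC gK fK gr fr.
split; apply: scalar_multiple fK gK _ _ _.
- exact: phi_e1.
- exact: lead_both PC f1 f1'.
- exact: lead_both PC g1 g1'.
- exact: phi_e3.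
- exact: lead_both PC f3 f3'.
- exact: lead_both PC g3 g3'.
Qed.

End RigidityOfRoots.

(** * Multiplicative filtrations and the square of the augmentation ideal *)

(** A decreasing filtration. Instances on the torus, on polynomials and on matrices serve to
    separate linear terms from products of two generators. *)
Record mult_filtration (K : fieldType) (A : algType K) (F : nat -> A -> Prop) : Prop :=
  MultFiltration {
    filt0 : forall n, F n 0;
    filt1 : F 0 1;
    filtS : forall n x, F n.+1 x -> F n x;
    filtD : forall n x y, F n x -> F n y -> F n (x + y);
    filtM : forall m n x y, F m x -> F n y -> F (m + n)%N (x * y);
    filtZ : forall n c x, F n x -> F n (c *: x) }.

Section AffineExpressions.
Variables (K : fieldType) (A : algType K).
Implicit Types (c l m : K) (u v x y : A).

Lemma affineD u v c l m y c' l' m' y' :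
  (c%:A + l *: u + m *: v + y) + (c'%:A + l' *: u + m' *: v + y') =
  (c + c')%:A + (l + l') *: u + (m + m') *: v + (y + y').
Proof.
by rewrite !scalerDl addrACA; congr (_ + _); rewrite addrACA; congr (_ + _); rewrite addrACA.
Qed.

Lemma affineZ u v a c l m y : a *: (c%:A + l *: u + m *: v + y) =
  (a * c)%:A + (a * l) *: u + (a * m) *: v + a *: y.
Proof. by rewrite !scalerDr !scalerA. Qed.

Lemma affineM x u v c l m y : x * (c%:A + l *: u + m *: v + y) =
  c *: x + (l *: (x * u) + m *: (x * v) + x * y).
Proof. by rewrite !mulrDr -!scalerAr mulr1 !addrA. Qed.

Lemma rmorph_affine (B : algType K) (h : {lrmorphism A -> B}) u v c l m y :
  h (c%:A + l *: u + m *: v + y) = c%:A + l *: h u + m *: h v + h y.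
Proof. by rewrite !rmorphD /= !linearZ rmorph1. Qed.

End AffineExpressions.

Section GeneratedFiltration.
Variables (K : fieldType) (q : K).
Local Notation U := (Uq q).
Local Notation e1 := (e1 q).
Local Notation e2 := (e2 q).

Definition gen_product (x : U) : Prop :=
  [\/ x = e1 * e1, x = e1 * e2, x = e2 * e1 | x = e2 * e2].

(** The square of the augmentation ideal (e1, e2). *)
Definition aug_sq : U -> Prop := ideal_generated gen_product.

Lemma aug_sqZ c x : aug_sq x -> aug_sq (c *: x).
Proof. by move=> xM; rewrite -mulr_algl; exact: ideal_mull. Qed.

Lemma linear_expansion x : exists c l m y,
  aug_sq y /\ x = c%:A + l *: e1 + m *: e2 + y.
Proof.
elim/Uq_ind_left: x => [|x x' IHx IHx'|a x IHx|x IHx|x IHx].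
- exists 1, 0, 0, 0; split; first exact: ideal_0.
  by rewrite !scale0r !addr0 scale1r.
- have [c [l [m [y [yM ->]]]]] := IHx; have [c' [l' [m' [y' [yM' ->]]]]] := IHx'.
  exists (c + c'), (l + l'), (m + m'), (y + y'); split; first exact: ideal_add.
  exact: affineD.
- have [c [l [m [y [yM ->]]]]] := IHx.
  exists (a * c), (a * l), (a * m), (a *: y); split; first exact: aug_sqZ.
  exact: affineZ.
- have [c [l [m [y [yM ->]]]]] := IHx.
  exists 0, c, 0, (l *: (e1 * e1) + m *: (e1 * e2) + e1 * y); split.
    apply: ideal_add; last exact: ideal_mull.
    by apply: ideal_add; apply/aug_sqZ/ideal_gen; [constructor 1|constructor 2].
  by rewrite affineM !scale0r add0r addr0.
have [c [l [m [y [yM ->]]]]] := IHx.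
exists 0, 0, c, (l *: (e2 * e1) + m *: (e2 * e2) + e2 * y); split.
  apply: ideal_add; last exact: ideal_mull.
  by apply: ideal_add; apply/aug_sqZ/ideal_gen; [constructor 3|constructor 4].
by rewrite affineM !scale0r !add0r.
Qed.

(** All of U^+ lands in degree 0, so multiplying a product of two degree 1 images by anything keeps
    it in degree 2. *)
Lemma filt_aug_sq (A : algType K) (F : nat -> A -> Prop) (h : {lrmorphism U -> A}) :
  mult_filtration F -> F 1 (h e1) -> F 1 (h e2) -> forall x, aug_sq x -> F 2 (h x).
Proof.
case=> F0 F1 FS FD FM FZ h1 h2.
have h0 x : F 0 (h x).
  elim/Uq_ind_left: x => [|x y IHx IHy|c x IHx|x IHx|x IHx].
  - by rewrite rmorph1.
  - by rewrite rmorphD; exact: FD.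
  - rewrite linearZ /=; exact: FZ.
  - by rewrite rmorphM; apply: FS; apply: (FM 1%N 0%N).
  - by rewrite rmorphM; apply: FS; apply: (FM 1%N 0%N).
move=> x; elim=> {x} [x|||a x _ IHx|a x _ IHx].
- by case=> ->; rewrite rmorphM; apply: (FM 1%N 1%N).
- by rewrite rmorph0.
- by move=> x y _ IHx _ IHy; rewrite rmorphD; exact: FD.
- by rewrite rmorphM; exact: (FM 0%N 2%N _ _ (h0 a) IHx).
- by rewrite rmorphM; exact: (FM 2%N 0%N _ _ IHx (h0 a)).
Qed.

End GeneratedFiltration.

(** * The degree filtration on the torus *)

Section TorusFiltration.
Variables (K : fieldType) (p q : K).
Hypotheses (p0 : p != 0) (pn : not_root_of_unity p).
Hypothesis pq : q ^+ 2 + q ^- 2 = p ^+ 2 + p ^- 2.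

Local Notation T := (qtorus (invsq p0)).
Local Notation mon := (mon (invsq p0)).
Local Notation phi := (phi p0 pn pq).

Definition ev00 : {rmorphism {poly {poly K}} -> K} :=
  [the {rmorphism _ -> _} of horner_eval (0 : K)]
  \o [the {rmorphism _ -> _} of horner_eval (0 : {poly K})].

Lemma ev00_cst a : ev00 (cst a) = a.
Proof. by rewrite cstE /= /horner_eval !hornerC. Qed.

Lemma ev00_z : ev00 'X%:P = 0.
Proof. by rewrite /= /horner_eval hornerC hornerX. Qed.

Lemma ev00_w : ev00 'X = 0.
Proof. by rewrite /= /horner_eval hornerX hornerC. Qed.

(* X has degree 1, Y has degree 2, and the central variables are set to 0. *)
Definition tfilt (n : nat) (t : T) : Prop :=
  forall m, ev00 (coef m t) != 0 -> n%:Z <= m.1 + 2 * m.2.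

Lemma tfilt_mult_filtration : mult_filtration tfilt.
Proof.
split.
- by move=> n m; rewrite qcoef0 rmorph0 eqxx.
- move=> m; rewrite -mon_1 coef_mon; case: (0 =P m) => [<- //|_].
  by rewrite mulr0n rmorph0 eqxx.
- by move=> n t tF m /tF; lia.
- move=> n s t sF tF m; rewrite qcoefD rmorphD /=.
  have [s0|/sF //] := eqVneq (ev00 (coef m s)) 0.
  by rewrite [X in X + _]s0 add0r => /tF.
- move=> k n s t sF tF m; rewrite qcoefM rmorph_sum => mN.
  have [l] : exists l : (int * int)%type, ev00 (coef l s) * ev00 (coef (m - l) t) != 0.
    apply/not_existsP => H; case/eqP: mN; rewrite big1 // => i _.
    apply/eqP; rewrite !rmorphM -mulrA mulf_eq0; apply/orP; right.
    by have /negP := H i; rewrite negbK.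
  rewrite mulf_eq0 negb_or => /andP[/sF + /tF].
  by clear mN; case: m l => [m1 m2] [l1 l2] /=; lia.
move=> n c t tF m; rewrite qcoefZ rmorphM mulf_eq0 negb_or => /andP[_]; exact: tF.
Qed.

Lemma tfilt_e1 : tfilt 1 (phi (e1 q)).
Proof.
rewrite phi_e1 => m; rewrite coef_mon; case: ((1, 0) =P m) => [<- //|_].
by rewrite mulr0n rmorph0 eqxx.
Qed.

(** Setting z = w = 0 leaves only the term Y X^-1 of [tE], of degree 2 - 1 = 1. *)
Lemma tfilt_e2 : tfilt 1 (phi (e2 q)).
Proof.
rewrite phi_e2 => m; rewrite /tE !qcoefD !coef_mon !(rmorphD ev00) !(rmorphMn ev00).
rewrite (rmorphM ev00) ev00_z ev00_w mulr0 !mul0rn add0r addr0.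
by case: ((-1, 1) =P m) => [<- //|_]; rewrite mulr0n eqxx.
Qed.

End TorusFiltration.

(** * One-dimensional representations of U^+ *)

Section AxisCharacters.
Variables (K : fieldType) (q : K).
Hypotheses (q0 : q != 0) (qn : not_root_of_unity q).
Local Notation U := (Uq q).

Definition gen (b : bool) : U := if b then e1 q else e2 q.

Let axis_image (b : bool) : {poly K} := if b then 'X else 0.

Fact axis_serre1 b : serre1 q (axis_image b) (axis_image (~~ b)) = 0.
Proof. by case: b; rewrite /serre1 /= ?(mulr0, mul0r, expr0n, scaler0, subr0, addr0). Qed.

Fact axis_serre2 b : serre2 q (axis_image b) (axis_image (~~ b)) = 0.
Proof. by case: b; rewrite /serre2 /= ?(mulr0, mul0r, expr0n, scaler0, subr0, addr0). Qed.

(** A whole coordinate axis of one-dimensional representations, with the polynomial variable as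
    coordinate. *)
Definition axis (b : bool) : {lrmorphism U -> {poly K}} :=
  Uq_lift (axis_serre1 b) (axis_serre2 b).

Lemma axis_gen b c : axis b (gen c) = if b == c then 'X else 0.
Proof. by case: c; [rewrite [LHS]Uq_lift_e1|rewrite [LHS]Uq_lift_e2]; case: b. Qed.

Lemma comm_serre1 (s t : {poly K}) :
  serre1 q s t = - (q - q^-1) ^+ 2 *: (s ^+ 2 * t).
Proof.
rewrite /serre1 (mulrC t) -(mulrA s t s) (mulrC t s) mulrA -expr2 addrAC -mulr2n.
rewrite -scaler_nat -scalerBl; congr (_ *: _).
by rewrite -exprVn; field.
Qed.

(** As q^2 is not 1, the first Serre relation reduces to s^2 t = 0 in a domain, so one generator
    goes to 0. The image of the other one is the polynomial substituted for the coordinate of the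
    axis. *)
Lemma commutative_char (h : {lrmorphism U -> {poly K}}) :
  exists b s, forall x, h x = axis b x \Po s.
Proof.
have : serre1 q (h (e1 q)) (h (e2 q)) = 0 by rewrite -rmorph_serre1 Uq_serre1 rmorph0.
rewrite comm_serre1 => /eqP; rewrite scaler_eq0 oppr_eq0 sqrf_eq0.
have -> : (q - q^-1 == 0) = false.
  apply/negP => /eqP H; have /negP[] := qn (n := 2) isT.
  have : q * (q - q^-1) = 0 by rewrite H mulr0.
  by rewrite mulrBr mulfV // -expr2 => /eqP; rewrite subr_eq0.
rewrite /= mulf_eq0 sqrf_eq0 => H.
have [b hb] : exists b, h (gen (~~ b)) = 0.
  by case/orP: H => /eqP H; [exists false|exists true].
exists b, (h (gen b)) => x.
pose h' : {lrmorphism U -> {poly K}} := comp_poly (h (gen b)) \o axis b.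
rewrite -[RHS]/(h' x); apply: Uq_hom_ext; rewrite /h' /=.
  rewrite -[e1 q]/(gen true) axis_gen; case: (b) hb => /= hb; first by rewrite comp_polyX.
  by rewrite comp_poly0.
rewrite -[e2 q]/(gen false) axis_gen; case: (b) hb => /= hb; last by rewrite comp_polyX.
by rewrite comp_poly0.
Qed.

End AxisCharacters.

(** * The linear part of an automorphism *)

Section PolynomialFiltration.
Variable K : fieldType.

Definition polyfilt (n : nat) (s : {poly K}) : Prop := exists t, s = t * 'X^n.

Lemma polyfilt_mult_filtration : mult_filtration polyfilt.
Proof.
split.
- by move=> n; exists 0; rewrite mul0r.
- by exists 1; rewrite expr0 mulr1.
- by move=> n _ [s ->]; exists (s * 'X); rewrite -mulrA -exprS.
- by move=> n _ _ [s ->] [t ->]; exists (s + t); rewrite mulrDl.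
- by move=> m n _ _ [s ->] [t ->]; exists (s * t); rewrite exprD mulrACA.
by move=> n c _ [s ->]; exists (c *: s); rewrite scalerAl.
Qed.

End PolynomialFiltration.

Section LinearPart.
Variables (K : fieldType) (q : K).
Hypotheses (q0 : q != 0) (qn : not_root_of_unity q).
Local Notation U := (Uq q).
Local Notation gen := (gen q).
Local Notation axis := (axis q).

Lemma gen_expansion x : exists c l y,
  aug_sq y /\ x = c%:A + l true *: gen true + l false *: gen false + y.
Proof.
have [c [l1 [l2 [y [yM ->]]]]] := linear_expansion x.
by exists c, (fun b : bool => if b then l1 else l2), y.
Qed.

(** [aug_sq] is sent into the multiples of 'X^2, so the two lowest coefficients see only the affine
    part. *)
Lemma axis_expansion b c l y : aug_sq y ->
  let x := c%:A + l true *: gen true + l false *: gen false + y in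
  (axis b x)`_0 = c /\ (axis b x)`_1 = l b.
Proof.
move=> yM x; rewrite {}/x rmorph_affine !axis_gen.
have axis1 d : polyfilt 1 (axis b (gen d)).
  rewrite axis_gen; case: eqP => _; last by exists 0; rewrite mul0r.
  by exists 1; rewrite mul1r.
have [t ->] := filt_aug_sq (polyfilt_mult_filtration K) (axis1 true) (axis1 false) yM.
rewrite !coefD !coefMXn !coefZ !coef1 mulr0 mulr1.
by case: b {axis1} => /=; rewrite !coefX !coef0 /= ?(mulr0, mulr1, addr0, add0r).
Qed.

Section Automorphism.
Variables f g : {lrmorphism U -> U}.
Hypotheses (fK : cancel f g) (gK : cancel g f).

(** The pullback of an axis is an axis composed with some s. At g(gen b) the value is 'X, so the
    degrees of the two composed polynomials multiply to 1. *)
Lemma axis_aut b : exists c (s : {poly K}), size s = 2%N /\ forall x, axis b (f x) = axis c x \Po s.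
Proof.
pose h : {lrmorphism U -> {poly K}} := axis b \o f.
have [c [s hE]] := commutative_char q0 qn h.
exists c, s; split=> //; have := hE (g (gen b)).
rewrite /h /= gK axis_gen eqxx => /(congr1 (fun r : {poly K} => (size r).-1)).
rewrite size_comp_poly size_polyX /= => /esym/eqP; rewrite muln_eq1.
by move=> /andP[_ /eqP]; case: (size s) => // n /= ->.
Qed.

(** If both axes pulled back to the same one, g(gen true), on which the pullback of the second axis
    vanishes, would also be killed by the pullback of the first, whose value there is 'X. *)
Lemma axis_aut_swap : exists sw : bool, forall b, exists s : {poly K},
  size s = 2%N /\ forall x, axis b (f x) = axis (b (+) sw) x \Po s.
Proof.
have [c [s [s2 cE]]] := axis_aut true; have [d [t [t2 dE]]] := axis_aut false.
have cd : c = ~~ d.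
  apply/eqP/negPn/negP => cd; have {cd} cd : c = d by case: (c) (d) cd => [] [].
  have := dE (g (gen true)); rewrite gK axis_gen (_ : (false == true) = false) // => /esym/eqP.
  rewrite comp_poly2_eq0 // -cd => /eqP H; have := cE (g (gen true)).
  by rewrite gK axis_gen eqxx H comp_poly0 => /eqP; rewrite polyX_eq0.
by exists d => -[]; [exists s; rewrite addTb -cd|exists t; rewrite addFb].
Qed.

(** Along axis [b] the image of the generator is a polynomial of degree 1, which gives the non-zero
    coefficient. Along the other axis it is 0, which removes the constant and the other linear
    term. *)
Lemma linear_part : exists sw : bool, forall b, exists (a : K) y,
  [/\ a != 0, aug_sq y & f (gen (b (+) sw)) = a *: gen b + y].
Proof.
have [sw H] := axis_aut_swap; exists sw => b.
have [s [s2 sE]] := H b; have [t [t2 tE]] := H (~~ b).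
have [c [l [y [yM xE]]]] := gen_expansion (f (gen (b (+) sw))).
have [] := axis_expansion b c l yM; have [] := axis_expansion (~~ b) c l yM.
rewrite -xE sE tE !axis_gen eqxx addNb comp_polyX.
rewrite (_ : (~~ (b (+) sw) == b (+) sw) = false); last by case: (_ (+) _).
rewrite comp_poly0 !coef0 => c0 lnb c0' lb.
have a0 : s`_1 != 0.
  have : lead_coef s != 0 by rewrite lead_coef_eq0 -size_poly_eq0 s2.
  by rewrite lead_coefE s2.
exists s`_1, y; split=> //; rewrite xE -c0 scale0r add0r lb.
by case: (b) lnb => /= <-; rewrite scale0r ?addr0 ?add0r.
Qed.

End Automorphism.
End LinearPart.

(** * Exclusion of the antidiagonal case by triangular matrices *)

Section UpperTriangularFiltration.
Variables (K : fieldType) (n : nat).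

Definition upper_filt (k : nat) (M : 'M[K]_n.+1) : Prop :=
  forall i j : 'I_n.+1, (j < i + k)%N -> M i j = 0.

Lemma upper_mult_filtration : mult_filtration upper_filt.
Proof.
split.
- by move=> k i j _; rewrite mxE.
- by move=> i j; rewrite addn0 mxE => ij; case: eqP => // ij'; rewrite ij' ltnn in ij.
- by move=> k M MF i j ij; apply: MF; rewrite addnS ltnW.
- by move=> k M N MF NF i j ij; rewrite mxE MF // NF // addr0.
- move=> k l M N MF NF i j ij; rewrite mxE big1 // => h _.
  have [hi|ih] := ltnP h (i + k); first by rewrite MF ?mul0r.
  by rewrite NF ?mulr0 //; lia.
by move=> k c M MF i j ij; rewrite mxE MF ?mulr0.
Qed.

End UpperTriangularFiltration.

Section SwapExclusion.
Variables (K : fieldType) (q : K).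
Local Notation U := (Uq q).
Local Notation gen := (gen q).
Local Notation M4 := 'M[K]_4.

Let i0 : 'I_4 := @Ordinal 4 0 isT.
Let i1 : 'I_4 := @Ordinal 4 1 isT.
Let i2 : 'I_4 := @Ordinal 4 2 isT.
Let i3 : 'I_4 := @Ordinal 4 3 isT.

Let X1 : M4 := delta_mx i2 i3.
Let X2 : M4 := delta_mx i0 i1 + delta_mx i1 i2.

Let X11 : X1 * X1 = 0.
Proof. exact: mul_delta_mx_0. Qed.

Let X12 : X1 * X2 = 0.
Proof. by rewrite mulrDr [X in X + _]mul_delta_mx_0 // [X in _ + X]mul_delta_mx_0 // addr0. Qed.

Let X222 : X2 * X2 * X2 = 0.
Proof.
have -> : X2 * X2 = delta_mx i0 i2.
  rewrite mulrDl !mulrDr [delta_mx i0 i1 * delta_mx i0 i1]mul_delta_mx_0 //.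
  rewrite [delta_mx i1 i2 * delta_mx i0 i1]mul_delta_mx_0 //.
  rewrite [delta_mx i1 i2 * delta_mx i1 i2]mul_delta_mx_0 //.
  by rewrite [delta_mx i0 i1 * delta_mx i1 i2]mul_delta_mx !addr0 add0r.
by rewrite mulrDr [X in X + _]mul_delta_mx_0 // [X in _ + X]mul_delta_mx_0 // addr0.
Qed.

Fact mx_serre1 : serre1 q X1 X2 = 0.
Proof. by rewrite /serre1 expr2 X11 X12 !mul0r mulr0 scaler0 subrr addr0. Qed.

Fact mx_serre2 : serre2 q X1 X2 = 0.
Proof.
rewrite /serre2 !exprS expr0 !mulr1 !mulrA X222 -!mulrA X12.
by rewrite !(mulrA X1) X12 !mul0r !mulr0 !scaler0 !subr0 addr0.
Qed.

(* In this representation [e2 * e2 * e1] is the matrix unit in the upper right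
   corner and the other words of length 3 with letters e1, e2, e2 vanish, so
   exchanging the generators violates the first Serre relation. *)
Definition mx_rep : {lrmorphism U -> M4} := Uq_lift mx_serre1 mx_serre2.

(** With strictly upper triangular factors, the only path from index 0 to index 3 in three steps
    rises by one each time. *)
Lemma upper3_entry (A B C : M4) :
  upper_filt 1 A -> upper_filt 1 B -> upper_filt 1 C ->
  (A * B * C) i0 i3 = A i0 i1 * B i1 i2 * C i2 i3.
Proof.
move=> AF BF CF; rewrite -!mulrA mxE (bigD1 i1) //= big1 ?addr0; last first.
  case=> [[|[|j]] // lt4] _; first by rewrite AF ?mul0r.
  rewrite [(B * C) _ _](@filtM _ _ _ (upper_mult_filtration K 3) 1 1) ?mulr0 //=; lia.
congr (_ * _); rewrite mxE (bigD1 i2) //= big1 ?addr0 //.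
case=> [[|[|[|j]]] // lt4] _; [by rewrite BF ?mul0r|by rewrite BF ?mul0r|].
by rewrite CF ?mulr0 //=; lia.
Qed.

(** The corner entry of the first Serre relation at the images [A] and [B] of f(e1) and f(e2) is b b
    a, from the word A A B. The other two words vanish there, as [B] agrees with a [X1] on the first
    superdiagonal. *)
Lemma no_swap (f : {lrmorphism U -> U}) a b y z : a != 0 -> b != 0 ->
  aug_sq y -> aug_sq z ->
  f (e1 q) = b *: e2 q + y -> f (e2 q) = a *: e1 q + z -> False.
Proof.
move=> a0 b0 yM zM f1 f2; have UF := upper_mult_filtration K 3.
have r1 : mx_rep (e1 q) = X1 by exact: Uq_lift_e1.
have r2 : mx_rep (e2 q) = X2 by exact: Uq_lift_e2.
have F1 : upper_filt 1 X1.
  by case=> [[|[|[|[|i]]]] // ?] [[|[|[|[|j]]]] // ?] //= _; rewrite mxE.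
have F2 : upper_filt 1 X2.
  by case=> [[|[|[|[|i]]]] // ?] [[|[|[|[|j]]]] // ?] //= _; rewrite !mxE addr0.
have yF : upper_filt 2 (mx_rep y) by apply: filt_aug_sq yM; rewrite ?r1 ?r2.
have zF : upper_filt 2 (mx_rep z) by apply: filt_aug_sq zM; rewrite ?r1 ?r2.
pose A := b *: X2 + mx_rep y; pose B := a *: X1 + mx_rep z.
have AF : upper_filt 1 A.
  by apply: (filtD UF); [exact: (filtZ UF)|exact: (filtS UF)].
have BF : upper_filt 1 B.
  by apply: (filtD UF); [exact: (filtZ UF)|exact: (filtS UF)].
have rD u v : mx_rep (u + v) = mx_rep u + mx_rep v by exact: rmorphD.
have rZ c u : mx_rep (c *: u) = c *: mx_rep u by exact: linearZ.
have : serre1 q A B = 0.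
  have -> : A = mx_rep (f (e1 q)) by rewrite f1 rD rZ r2.
  have -> : B = mx_rep (f (e2 q)) by rewrite f2 rD rZ r1.
  by rewrite -(rmorph_serre1 mx_rep) -(rmorph_serre1 f) Uq_serre1 !rmorph0.
pose E (M : M4) := M i0 i3.
have ED M N : E (M + N) = E M + E N by rewrite /E mxE.
have EN M : E (- M) = - E M by rewrite /E mxE.
have EZ c M : E (c *: M) = c * E M by rewrite /E mxE.
move/(congr1 E); rewrite /serre1 !expr2 mulrA !ED EN EZ /E !upper3_entry //.
have -> : B i1 i2 = 0 by rewrite !mxE zF //= ?mxE /= ?(addr0, add0r, mulr0, mulr1).
have -> : B i0 i1 = 0 by rewrite !mxE zF //= ?mxE /= ?(addr0, add0r, mulr0, mulr1).
have -> : A i0 i1 = b by rewrite !mxE yF //= ?mxE /= ?(addr0, add0r, mulr0, mulr1).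
have -> : A i1 i2 = b by rewrite !mxE yF //= ?mxE /= ?(addr0, add0r, mulr0, mulr1).
have -> : B i2 i3 = a by rewrite !mxE zF //= ?mxE /= ?(addr0, add0r, mulr0, mulr1).
rewrite !mulr0 !mul0r mulr0 subr0 addr0 !mxE => /eqP.
by rewrite !mulf_eq0 (negPf a0) (negPf b0).
Qed.

End SwapExclusion.

(** * Occurrence of X and Y in the images of e1 and e3 *)

Section RootTerms.
Variables (K : fieldType) (p q : K).
Hypotheses (p0 : p != 0) (pn : not_root_of_unity p).
Hypothesis pq : q ^+ 2 + q ^- 2 = p ^+ 2 + p ^- 2.

Local Notation U := (Uq q).
Local Notation e1 := (e1 q).
Local Notation e2 := (e2 q).
Local Notation e3 := (e3 p q).
Local Notation phi := (phi p0 pn pq).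
Local Notation tfilt := (@tfilt K p p0).
Local Notation ev00 := (ev00 K).

Variables (f : {lrmorphism U -> U}) (a b : K) (y1 y2 : U).
Hypotheses (y1M : aug_sq y1) (y2M : aug_sq y2).
Hypotheses (f1 : f e1 = a *: e1 + y1) (f2 : f e2 = b *: e2 + y2).

Let TF : mult_filtration tfilt := tfilt_mult_filtration p0.

Let phiM2 y : aug_sq y -> tfilt 2 (phi y).
Proof.
move=> yM; apply: (filt_aug_sq (h := phi) TF) yM; first exact: tfilt_e1.
exact: tfilt_e2.
Qed.

Let phiD u v : phi (u + v) = phi u + phi v. Proof. exact: rmorphD. Qed.
Let phiZ c u : phi (c *: u) = c *: phi u. Proof. exact: linearZ. Qed.

(** The correction [y1] has filtration degree 2, while X has degree 1. *)
Lemma root_term1 : ev00 (coef (1, 0) (phi (f e1))) = a.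
Proof.
have -> : phi (f e1) = a *: tX p0 + phi y1.
  by rewrite f1 phiD phiZ phi_e1.
rewrite qcoefD qcoefZ coef_mon eqxx mulr1n mulr1 (rmorphD ev00) ev00_cst.
have /eqP -> : ev00 (coef (1, 0) (phi y1)) == 0; last by rewrite addr0.
by apply/negPn/negP => /(phiM2 y1M).
Qed.

Lemma qcomm_lin (A : algType K) (x x' u u' : A) :
  qcomm p (a *: x + u) (b *: x' + u') =
  (a * b) *: qcomm p x x' +
  (a *: qcomm p x u' + b *: qcomm p u x' + qcomm p u u').
Proof.
have qZl c (z z' : A) : qcomm p (c *: z) z' = c *: qcomm p z z'.
  by rewrite /qcomm -scalerAl -scalerAr scalerBr !scalerA mulrC.
have qZr c (z z' : A) : qcomm p z (c *: z') = c *: qcomm p z z'.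
  by rewrite /qcomm -scalerAl -scalerAr scalerBr !scalerA mulrC.
by rewrite qcommDl !qcommDr !(qZl, qZr) scalerA !addrA.
Qed.

(** By bilinearity f(e3) is a b e3 plus q-commutators of filtration degree at least 3, while Y has
    degree 2. *)
Lemma root_term3 : ev00 (coef (0, 1) (phi (f e3))) = a * b.
Proof.
have FQ k l s t : tfilt k s -> tfilt l t -> tfilt (k + l)%N (qcomm p s t).
  move=> sF tF; rewrite /qcomm; apply: (filtD TF); first exact: (filtM TF).
  by rewrite -scaleNr; apply: (filtZ TF); rewrite addnC; exact: (filtM TF).
have T1 : tfilt 1 (phi e1) by exact: tfilt_e1.
have T2 : tfilt 1 (phi e2) by exact: tfilt_e2.
have [r rF ->] : exists2 r, tfilt 3 r & phi (f e3) = (a * b) *: tY p0 + r.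
  exists (a *: qcomm p (phi e1) (phi y2) + b *: qcomm p (phi y1) (phi e2)
    + qcomm p (phi y1) (phi y2)).
    apply: (filtD TF); first apply: (filtD TF).
    - by apply: (filtZ TF); apply: (FQ 1%N 2%N) => //; exact: phiM2.
    - by apply: (filtZ TF); apply: (FQ 2%N 1%N) => //; exact: phiM2.
    by apply: (filtS TF); apply: (FQ 2%N 2%N) => //; exact: phiM2.
  rewrite -(phi_e3 p0 pn pq) e3E !rmorph_qcomm -qcomm_lin f1 f2.
  by rewrite !phiD !phiZ.
rewrite qcoefD qcoefZ coef_mon eqxx mulr1n mulr1 (rmorphD ev00) ev00_cst.
have /eqP -> : ev00 (coef (0, 1) r) == 0; last by rewrite addr0.
by apply/negPn/negP => /rF.
Qed.

Lemma root_terms : a != 0 -> b != 0 -> has_root_terms p0 pn pq f.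
Proof.
move=> a0 b0; split.
  by apply: contraNneq a0 => H; rewrite -root_term1 H rmorph0.
have := mulf_neq0 a0 b0; apply: contraNneq => H.
by rewrite -root_term3 H rmorph0.
Qed.

Lemma scaled_root c : f e3 = c *: e3 -> c = a * b.
Proof.
move=> fE; rewrite -root_term3 fE.
by rewrite phiZ phi_e3 qcoefZ coef_mon eqxx mulr1n mulr1 ev00_cst.
Qed.

Lemma scaled_simple_root c : f e1 = c *: e1 -> c = a.
Proof.
move=> fE; rewrite -root_term1 fE.
by rewrite phiZ phi_e1 qcoefZ coef_mon eqxx mulr1n mulr1 ev00_cst.
Qed.

(** In the torus, multiplication by X only shifts exponents and rescales coefficients by units. *)
Lemma mul_e1_inj x : x * e1 = 0 -> x = 0.
Proof.
move=> xe; apply: (@phi_inj K p q p0 pn pq); rewrite rmorph0.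
have : phi x * tX p0 = 0.
  by rewrite -(phi_e1 p0 pn pq); rewrite -[LHS]rmorphM xe rmorph0.
move=> H; apply/qtorusP => m; have /(congr1 (coef (m + (1, 0)))) := H.
rewrite coef_Mmon addrK mulr1 !qcoef0 => /eqP; rewrite mulf_eq0 cst_eq0.
by rewrite (negPf (tw_neq0 _ _ _)) => /eqP.
Qed.

End RootTerms.

(** * Every automorphism rescales the generators *)

Lemma not_root_of_unityV (K : fieldType) (q : K) :
  not_root_of_unity q -> not_root_of_unity q^-1.
Proof. by move=> qn n n0; rewrite exprVn invr_eq1 qn. Qed.

Lemma aut_scaling (K : fieldType) (q : K) (f g : {lrmorphism Uq q -> Uq q}) :
  q != 0 -> not_root_of_unity q -> cancel f g -> cancel g f ->
  exists a b, [/\ a != 0, b != 0, f (e1 q) = a *: e1 q & f (e2 q) = b *: e2 q].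
Proof.
move=> q0 qn fK gK.
have lin (h k : {lrmorphism Uq q -> Uq q}) : cancel k h ->
    exists a b y1 y2, [/\ a != 0, b != 0, aug_sq y1, aug_sq y2 &
      h (e1 q) = a *: e1 q + y1 /\ h (e2 q) = b *: e2 q + y2].
  move=> kK; have [[] H] := linear_part q0 qn kK.
    have [a [y [a0 yM hy]]] := H true; have [b [z [b0 zM hz]]] := H false.
    by case: (no_swap a0 b0 zM yM hz hy).
  have [a [y [a0 yM hy]]] := H true; have [b [z [b0 zM hz]]] := H false.
  by exists a, b, y, z.
have [a [b [y1 [y2 [a0 b0 y1M y2M [f1 f2]]]]]] := lin f g gK.
have [a' [b' [z1 [z2 [a0' b0' z1M z2M [g1 g2]]]]]] := lin g f fK.
(* Stated for every admissible p, with a and b independent of p, in order to be applied to both q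
   and its inverse. *)
have V p (p0 : p != 0) (pn : not_root_of_unity p)
    (pq : q ^+ 2 + q ^- 2 = p ^+ 2 + p ^- 2) :
    f (e1 q) = a *: e1 q /\ f (qcomm p (e1 q) (e2 q)) = (a * b) *: qcomm p (e1 q) (e2 q).
  have [[c c0 fc] [d d0 fd]] := rigidity fK gK
    (root_terms p0 pn pq y1M y2M f1 f2 a0 b0) (root_terms p0 pn pq z1M z2M g1 g2 a0' b0').
  rewrite -e3E -(scaled_root p0 pn pq y1M y2M f1 f2 fd).
  by rewrite -(scaled_simple_root p0 pn pq y1M f1 fc).
have [fe1 fe3] := V _ q0 qn erefl.
have q0' : q^-1 != 0 by rewrite invr_eq0.
have pq' : q ^+ 2 + q ^- 2 = q^-1 ^+ 2 + q^-1 ^- 2 by rewrite exprVn invrK addrC.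
have [_ fe3'] := V _ q0' (not_root_of_unityV qn) pq'.
exists a, b; split=> //.
have fB u v : f (u - v) = f u - f v by exact: rmorphB.
have fZ c u : f (c *: u) = c *: f u by exact: linearZ.
have fM u v : f (u * v) = f u * f v by exact: rmorphM.
(* The q-commutators for q and for its inverse are both scaled by a b, and their difference is (q^-2
   - q^2) e2 e1. *)
have H21 : f (e2 q * e1 q) = (a * b) *: (e2 q * e1 q).
  have span (d c : K) x y z : d != 0 -> d *: x = y - z ->
      f y = c *: y -> f z = c *: z -> f x = c *: x.
    move=> d0 E fy fz; apply: (scalerI d0); rewrite -fZ E fB fy fz -scalerBr -E.
    by rewrite !scalerA mulrC.
  apply: (span (q^-1 ^+ 2 - q ^+ 2)) fe3 fe3'; first by rewrite exprVn; exact: subVsq_neq0.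
  by rewrite /qcomm opprB [RHS]addrC addrA subrK scalerBl.
(* Since f(e2) f(e1) = a b e2 e1 and f(e1) = a e1, cancelling a e1 on the right leaves f(e2) = b
   e2. *)
apply/eqP; rewrite -subr_eq0; apply/eqP/(mul_e1_inj q0 qn erefl)/(scalerI a0).
rewrite scaler0 mulrBl scalerBr scalerAr -fe1 -fM H21 -scalerAl scalerA.
by rewrite subrr.
Qed.

(** * The isomorphism with the torus *)

Section TorusAction.
Variables (K : fieldType) (q : K).
Hypotheses (q0 : q != 0) (qn : not_root_of_unity q).

Lemma e1_neq0 : e1 q != 0.
Proof.
apply/eqP => /(congr1 (phi q0 qn erefl)); rewrite phi_e1 rmorph0.
move/(congr1 (coef (1, 0))); rewrite coef_mon eqxx qcoef0 => /eqP.
by rewrite oner_eq0.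
Qed.

Lemma e2_neq0 : e2 q != 0.
Proof.
apply/eqP => e20; have e30 : e3 q q = 0 by rewrite e3E e20 /qcomm mulr0 mul0r scaler0 subrr.
have := phi_e3 q0 qn erefl; rewrite e30 rmorph0 => /esym/(congr1 (coef (0, 1))).
by rewrite coef_mon eqxx qcoef0 => /eqP; rewrite oner_eq0.
Qed.

Lemma scale_inj (V : lmodType K) (v : V) : v != 0 -> injective (fun c : K => c *: v).
Proof.
move=> v0 c d /eqP; rewrite -subr_eq0 -scalerBl scaler_eq0 (negPf v0) orbF subr_eq0.
by move/eqP.
Qed.

Lemma algAut_psi (f : algAut (Uq q)) : exists alpha beta, f = psi q alpha beta.
Proof.
have [a [b [a0 b0 f1 f2]]] :=
  aut_scaling q0 qn (algAutK f : cancel f (algAut_inv f)) (algAut_invfunK f).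
exists (Nonzero a0), (Nonzero b0); apply: algAutP.
by apply: Uq_hom_ext; rewrite ?psi_e1 ?psi_e2.
Qed.

Definition torus_act (ab : nonzero K * nonzero K) : algAut (Uq q) := psi q ab.1 ab.2.

Lemma torus_act_inj : injective torus_act.
Proof.
move=> [a b] [c d] H.
have H1 := congr1 (fun f : algAut (Uq q) => f (e1 q)) H.
have H2 := congr1 (fun f : algAut (Uq q) => f (e2 q)) H.
have /val_inj -> : val a = val c.
  by apply: (scale_inj e1_neq0); exact: etrans (esym (psi_e1 q a b)) (etrans H1 (psi_e1 q c d)).
have /val_inj -> : val b = val d.
  by apply: (scale_inj e2_neq0); exact: etrans (esym (psi_e2 q a b)) (etrans H2 (psi_e2 q c d)).
by [].
Qed.

Lemma torus_actM : {morph torus_act : x y / (x * y)%g}.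
Proof.
move=> x y; apply: algAutP; apply: Uq_hom_ext.
  rewrite [LHS]psi_e1 /= -[RHS]/(psi q x.1 x.2 (psi q y.1 y.2 (e1 q))) psi_e1.
  by rewrite [RHS]linearZ /= psi_mor_e1 scalerA mulrC.
rewrite [LHS]psi_e2 /= -[RHS]/(psi q x.1 x.2 (psi q y.1 y.2 (e2 q))) psi_e2.
by rewrite [RHS]linearZ /= psi_mor_e2 scalerA mulrC.
Qed.

Lemma torus_act_surj f : exists ab, torus_act ab = f.
Proof. by have [a [b ->]] := algAut_psi f; exists (a, b). Qed.

End TorusAction.

Local Open Scope classical_set_scope.

Theorem theorem4p4 (R : realType) (q : R[i]) (q_neq0 : q != 0)
    (q_not_root_of_unity : forall n : nat, (0 < n)%N -> q ^+ n != 1) :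
  [set: algAut (Uq q)] =
    [set f | exists alpha beta : nonzero R[i], f = psi q alpha beta]
  /\ isomorphic_groups (algAut (Uq q)) (nonzero R[i] * nonzero R[i])%type.
Proof.
split.
  by apply/seteqP; split=> // f _; exact: algAut_psi.
(* A section of the surjective [torus_act] is its inverse by injectivity, and inherits
   multiplicativity from it. *)
have [h hK] := choice (torus_act_surj q_neq0 q_not_root_of_unity).
have actI := torus_act_inj q_neq0 q_not_root_of_unity.
have hM : {morph h : x y / (x * y)%g} by move=> f g; apply: actI; rewrite torus_actM !hK.
pose hm : {multiplicative algAut (Uq q) -> (nonzero R[i] * nonzero R[i])%type} :=
  HB.pack h (mathcomp.boot.monoid.isMultiplicative.Build _ _ h hM).
exists hm; exists (@torus_act _ q); first exact: hK.
by move=> x; apply: actI; rewrite hK.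
Qed.
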